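(* There exists $\gamma_0>0$ such that for every $\gamma\in(0,\gamma_0]$ there exist $\mu_0>0$ and $n_0$ such that for every $\mu\in(0,\mu_0]$ and $n\ge n_0$: if $G$ is a graph on $n$ vertices with $\delta(G)\ge n/2$ that is $\gamma$-close to $2K_{n/2}$, then every $\mu n$-bounded colouring of $E(G)$ admits a rainbow Hamilton cycle in $G$.
   Context: A graph $G$ on $n$ vertices is $\gamma$-close to $2K_{n/2}$ if there exists $A\subseteq V(G)$ with $|A|=\lfloor n/2\rfloor$ such that the number of edges between $A$ and $V(G)\setminus A$ is at most $\gamma n^2$. An edge-colouring is $k$-bounded if no colour appears on more than $k$ edges; a subgraph is rainbow if its edges have pairwise distinct colours. *)

(* Defs.v *)
From mathcomp Require Import all_boot.
From Stdlib Require Import Reals.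
Set Implicit Arguments. Unset Strict Implicit. Unset Printing Implicit Defensive.

Definition simple_graph (n : nat) (e : rel 'I_n) : Prop :=
  (forall u v, e u v = e v u) /\ (forall u, e u u = false).

Definition deg (n : nat) (e : rel 'I_n) (v : 'I_n) : nat := #|[set u | e v u]|.

Definition min_deg_half (n : nat) (e : rel 'I_n) : Prop :=
  forall v, (INR (deg e v) >= INR n / 2)%R.

Definition cut_size (n : nat) (e : rel 'I_n) (A : {set 'I_n}) : nat :=
  #|[set p : 'I_n * 'I_n | [&& p.1 \in A, p.2 \notin A & e p.1 p.2]]|.

Definition gamma_close (n : nat) (e : rel 'I_n) (gamma : R) : Prop :=
  exists A : {set 'I_n}, #|A| = n./2 /\ (INR (cut_size e A) <= gamma * INR n ^ 2)%R.

(* An edge-colouring of G: colours of edges, given symmetrically (colour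
   values on non-edges are irrelevant). *)
Definition edge_colouring (n : nat) (c : 'I_n -> 'I_n -> nat) : Prop :=
  forall u v, c u v = c v u.

Definition colour_class_size (n : nat) (e : rel 'I_n) (c : 'I_n -> 'I_n -> nat)
  (k : nat) : nat :=
  #|[set p : 'I_n * 'I_n | [&& (p.1 < p.2)%N, e p.1 p.2 & c p.1 p.2 == k]]|.

Definition bounded_colouring (n : nat) (e : rel 'I_n) (c : 'I_n -> 'I_n -> nat)
  (b : R) : Prop :=
  forall k, (INR (colour_class_size e c k) <= b)%R.

Definition hamilton_cycle (n : nat) (e : rel 'I_n) (s : seq 'I_n) : Prop :=
  (3 <= n)%N /\ perm_eq s (enum 'I_n) /\ cycle e s.

Definition rainbow_cycle (n : nat) (c : 'I_n -> 'I_n -> nat) (s : seq 'I_n) : Prop :=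
  uniq [seq c p.1 p.2 | p <- zip s (rot 1 s)].

(* Main.v *)
Require Import Defs.
From mathcomp Require Import all_boot zify.
From Stdlib Require Import Reals Lra.
Set Implicit Arguments. Unset Strict Implicit. Unset Printing Implicit Defensive.

(* Moving the few vertices with many crossing edges to their majority side gives a partition
   in which all other ("good") vertices see almost all of their side, and every vertex sees a
   positive proportion of the good vertices of its side. The minimum degree yields two disjoint
   crossing edges of different colours. Keep these two and, inside the sides, only edges with a
   good end whose colour differs from both. This graph has a Hamilton cycle: by 2-opt moves one
   removes the missing edges of a cyclic ordering, one after the other. On the set of all its
   Hamilton cycles, listed with all rotations and reflections, the lopsided local lemma applies
   to the events "both edges of a monochromatic pair are used": a 2-opt move at an edge vx
   creates only edges at v or x, hence no event disjoint from vx, and there are linearly many of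
   them, so that even conditionally an edge is used with probability O(1/n). A vertex meets
   O(mu n^2) monochromatic pairs, each of probability O(1/n^2). *)

(** * The lopsided local lemma *)

Definition avoiding (T I : finType) (W : {set T}) (B : I -> pred T)
  (S : {set I}) : {set T} := [set t in W | [forall i in S, ~~ B i t]].

Lemma avoidingU (T I : finType) (W : {set T}) (B : I -> pred T) (S : {set I}) i :
  avoiding W B (i |: S) = avoiding W B S :\: [set t in avoiding W B S | B i t].
Proof.
apply/setP => t; rewrite !inE; case: (t \in W) => //=.
apply/forall_inP/idP => [H | /andP[/nandP H1 /forall_inP H2] j].
  apply/andP; split; last by apply/forall_inP => j jS; apply: H; rewrite !inE jS orbT.
  by rewrite (negbTE (H i _)) ?andbF // !inE eqxx.
rewrite !inE => /predU1P[-> | jS]; last exact: H2.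
by case: H1 => // /negP[]; apply/forall_inP.
Qed.

Lemma avoidingS (T I : finType) (W : {set T}) (B : I -> pred T) (S S' : {set I}) :
  S' \subset S -> avoiding W B S \subset avoiding W B S'.
Proof.
move=> /subsetP sS; apply/subsetP => t; rewrite !inE => /andP[-> /forall_inP H] /=.
by apply/forall_inP => j /sS; apply: H.
Qed.

(** Counting form, with [W] as the probability space: [a/b] bounds the probability of an event
    conditioned on avoiding non-neighbours. By induction on the size of [S], conditioning on
    avoiding an arbitrary [S] at most doubles the bound: the neighbours of [i] in [S], few by the
    last hypothesis and each of conditional probability at most [2a/b], destroy at most half of what
    avoids the rest of [S]. *)
Lemma lopsided_local_lemma (T I : finType) (W : {set T}) (B : I -> pred T)
    (Q : {set I}) (nb : rel I) (a b : nat) :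
  0 < #|W| -> 2 * a < b ->
  (forall i (S : {set I}), i \in Q -> S \subset Q -> (forall j, j \in S -> ~~ nb i j) ->
     b * #|[set t in avoiding W B S | B i t]| <= a * #|avoiding W B S|) ->
  (forall i, i \in Q -> 4 * a * #|[set j in Q | nb i j]| <= b) ->
  exists t, t \in avoiding W B Q.
Proof.
move=> W0 ab Hp Hn.
have key : forall m i (S : {set I}), #|S| < m -> i \in Q -> S \subset Q ->
    b * #|[set t in avoiding W B S | B i t]| <= 2 * a * #|avoiding W B S|.
  elim=> [//|m IH] i S Sm iQ SQ.
  pose S1 := [set j in S | ~~ nb i j]; pose S2 := [set j in S | nb i j].
  have S1S : S1 \subset S by apply/subsetP => j; rewrite inE => /andP[].
  have S1Q := subset_trans S1S SQ.
  have h1 : b * #|[set t in avoiding W B S1 | B i t]| <= a * #|avoiding W B S1|.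
    by apply: Hp => // j; rewrite inE => /andP[].
  have h2 : #|[set t in avoiding W B S | B i t]| <= #|[set t in avoiding W B S1 | B i t]|.
    apply: subset_leq_card; apply/subsetP => t; rewrite !inE => /andP[/andP[tW H] ->].
    rewrite tW andbT; apply/forall_inP => j jS1; exact: (forall_inP H) (subsetP S1S _ jS1).
  suff h3 : #|avoiding W B S1| <= 2 * #|avoiding W B S|.
    by have : b * #|[set t in avoiding W B S | B i t]| <= b * #|[set t in avoiding W B S1 | B i t]|;
      [rewrite leq_mul2l h2 orbT | nia].
  (* Without neighbours of [i] in [S], the sets [S] and [S1] coincide; otherwise [S1] is smaller and
     the induction hypothesis applies to it. *)
  have [E|[k kS2]] := set_0Vmem S2.
    have -> : S = S1.
      apply/setP => j; rewrite !inE; case jS: (j \in S) => //=; symmetry; apply/negP => nj.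
      by have : j \in S2; [rewrite inE jS nj | rewrite E inE].
    lia.
  have S1m : #|S1| < m.
    apply: (@leq_trans #|S|) => //; apply: proper_card; apply/properP; split=> //.
    by exists k; move: kS2; rewrite !inE => /andP[kS nk]; rewrite ?kS ?nk.
  have h4 : #|avoiding W B S1 :\: avoiding W B S|
      <= \sum_(j in S2) #|[set t in avoiding W B S1 | B j t]|.
    have -> : avoiding W B S1 :\: avoiding W B S
        = \bigcup_(j in S2) [set t in avoiding W B S1 | B j t].
      apply/setP => t; apply/setDP/bigcupP => [[t1 tS] | [j jS2]]; last first.
        rewrite inE => /andP[t1 Bj]; split=> //; rewrite inE negb_and; apply/orP; right.
        apply/forall_inPn; exists j; last by rewrite negbK.
        by move: jS2; rewrite inE => /andP[].
      have tW : t \in W by move: t1; rewrite inE => /andP[].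
      move: tS; rewrite inE tW => /forall_inPn[j jS]; rewrite negbK => Bj.
      exists j; last by rewrite inE t1.
      rewrite inE jS; apply/negPn/negP => nj; move: t1; rewrite inE tW => /forall_inP/(_ j).
      by rewrite inE jS nj Bj => /(_ isT).
    elim/big_rec2: _ => [|j x y _ le]; first by rewrite cards0.
    by apply: leq_trans (leq_card_setU _ _) _; rewrite leq_add2l.
  have h5 : b * #|avoiding W B S1 :\: avoiding W B S|
      <= #|S2| * (2 * a * #|avoiding W B S1|).
    rewrite -sum_nat_const; apply: leq_trans (leq_mul (leqnn b) h4) _.
    rewrite big_distrr /=; apply: leq_sum => j; rewrite inE => /andP[jS _].
    by apply: IH => //; apply: (subsetP SQ).
  have h6 : 4 * a * #|S2| <= b.
    apply: leq_trans (Hn i iQ); rewrite leq_mul2l; apply/orP; right.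
    apply: subset_leq_card; apply/subsetP => j; rewrite !inE => /andP[jS ->].
    by rewrite (subsetP SQ _ jS).
  have := cardsD (avoiding W B S1) (avoiding W B S).
  rewrite (setIidPr (avoidingS W B S1S)) => h7; rewrite h7 in h5.
  have h8 := subset_leq_card (avoidingS W B S1S).
  nia.
(* When the events are added one by one, each step keeps a positive proportion, as [2a < b]. *)
suff pos : forall m (S : {set I}), #|S| = m -> S \subset Q -> 0 < #|avoiding W B S|.
  by have /card_gt0P[t tQ] := pos _ Q erefl (subxx _); exists t.
elim=> [|m IH] S.
  move/eqP; rewrite cards_eq0 => /eqP-> _; apply: leq_trans W0 _.
  by apply: subset_leq_card; apply/subsetP => t tW; rewrite inE tW; apply/forall_inP => j; rewrite inE.
move=> Sm SQ; have /card_gt0P[i iS] : 0 < #|S| by rewrite Sm.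
have SiQ : S :\ i \subset Q by apply: subset_trans SQ; apply: subsetDl.
have cSi : #|S :\ i| = m by move: Sm; rewrite (cardsD1 i) iS => -[].
rewrite -(setD1K iS) avoidingU cardsD.
have := IH _ cSi SiQ; have := key _ i _ (leqnn _) (subsetP SQ _ iS) SiQ.
set F := avoiding _ _ _; set E := [set _ in _ | _] => h hF.
have -> : F :&: E = E by apply/setIidPr/subsetP => t; rewrite inE => /andP[].
nia.
Qed.

(** * Cyclic sequences and 2-opt moves *)

Definition lpairs (V : Type) (s : seq V) := zip s (behead s).
Definition cpairs (V : Type) (s : seq V) := zip s (rot 1 s).
Definition cadj (V : eqType) (s : seq V) (u w : V) :=
  ((u, w) \in cpairs s) || ((w, u) \in cpairs s).
Definition ladj (V : eqType) (s : seq V) (u w : V) :=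
  ((u, w) \in lpairs s) || ((w, u) \in lpairs s).
Definition same_edge (V : eqType) (a b u w : V) :=
  ((u, w) == (a, b)) || ((w, u) == (a, b)).

Lemma lpairs_cat (V : Type) (x0 : V) (s1 s2 : seq V) : 0 < size s1 -> 0 < size s2 ->
  lpairs (s1 ++ s2) = lpairs s1 ++ (last x0 s1, head x0 s2) :: lpairs s2.
Proof.
case: s1 => // x s1 _; case: s2 => // y s2 _.
rewrite /lpairs /=; elim: s1 x => [//|z s1 IH] x /=.
by congr cons; rewrite -IH.
Qed.

Lemma cpairsE (V : Type) (x0 : V) (s : seq V) : 0 < size s ->
  cpairs s = rcons (lpairs s) (last x0 s, head x0 s).
Proof.
case: s => // x s _; rewrite /cpairs rot1_cons /lpairs /=.
move: {2 5}x; elim: s x => [//|y s IH] x z /=; by congr cons; rewrite IH.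
Qed.

Lemma cpairs_cat (V : Type) (x0 : V) (s1 s2 : seq V) : 0 < size s1 -> 0 < size s2 ->
  cpairs (s1 ++ s2) = lpairs s1 ++ (last x0 s1, head x0 s2) ::
    rcons (lpairs s2) (last x0 s2, head x0 s1).
Proof.
move=> h1 h2; rewrite (cpairsE x0); last by rewrite size_cat ltn_addr.
rewrite (lpairs_cat x0) // rcons_cat /= last_cat.
by case: s1 h1 => // a s1 _; case: s2 h2.
Qed.

Lemma lpairs_rev (V : Type) (s : seq V) :
  lpairs (rev s) = rev (map (@swap_pair V V) (lpairs s)).
Proof.
case: s => // x s; elim: s x => [//|y s IH] x.
rewrite rev_cons -cats1 (lpairs_cat x) ?size_rev //= IH.
have -> : last x (rev (y :: s)) = y by rewrite rev_cons last_rcons.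
by rewrite rev_cons -cats1.
Qed.

Lemma cpairs_rot (V : Type) k (s : seq V) : cpairs (rot k s) = rot k (cpairs s).
Proof.
have [le|lt] := leqP (size s) k.
  by rewrite !rot_oversize // /cpairs size_zip size_rot minnn.
rewrite /cpairs; have -> : rot 1 (rot k s) = rot k (rot 1 s) by rewrite rot_rot.
have : size s = size (rot 1 s) by rewrite size_rot.
move: (rot 1 s) => r szr.
have sz : size (take k s) = size (take k r) by rewrite !size_take szr.
have sk : size (zip (take k s) (take k r)) = k by rewrite size_zip sz minnn size_takel // -szr ltnW.
have -> : zip s r = zip (take k s) (take k r) ++ zip (drop k s) (drop k r).
  by rewrite -zip_cat ?cat_take_drop.
by rewrite /rot zip_cat ?size_drop ?szr // drop_size_cat // take_size_cat.
Qed.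

Lemma cpairs_rev (V : Type) (s : seq V) :
  exists k, cpairs (rev s) = rot k (rev (map (@swap_pair V V) (cpairs s))).
Proof.
case: s => [|x s]; first by exists 0.
exists 1; rewrite (cpairsE x) ?size_rev // (cpairsE x) // lpairs_rev.
rewrite map_rcons rev_rcons rot1_cons; congr (rcons _ (_, _)).
  by rewrite rev_cons last_rcons.
by rewrite /= (last_nth x) /= -nth0 nth_rev // subn1.
Qed.

Lemma cadj_rot (V : eqType) k (s : seq V) : cadj (rot k s) =2 cadj s.
Proof. by move=> u w; rewrite /cadj cpairs_rot !mem_rot. Qed.

Lemma cadj_rev (V : eqType) (s : seq V) : cadj (rev s) =2 cadj s.
Proof.
move=> u w; rewrite /cadj; have [k ->] := cpairs_rev s; rewrite !mem_rot !mem_rev.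
by rewrite -[(u, w)]swap_pairK -[(w, u)]swap_pairK !(mem_map (can_inj (@swap_pairK V V))) orbC.
Qed.

Lemma cadjC (V : eqType) (s : seq V) u w : cadj s u w = cadj s w u.
Proof. by rewrite /cadj orbC. Qed.

Lemma ladj_rev (V : eqType) (s : seq V) : ladj (rev s) =2 ladj s.
Proof.
move=> u w; rewrite /ladj lpairs_rev !mem_rev.
by rewrite -[(u, w)]swap_pairK -[(w, u)]swap_pairK !(mem_map (can_inj (@swap_pairK V V))) orbC.
Qed.

Lemma cycle_cpairs (V : eqType) (e : rel V) (s : seq V) :
  cycle e s = all (fun p => e p.1 p.2) (cpairs s).
Proof.
case: s => // x s; rewrite (cpairsE x) // all_rcons /=.
rewrite rcons_path andbC; congr andb; rewrite /lpairs /=.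
by elim: s x => //= y s IH x; rewrite IH.
Qed.

Lemma cycle_cadj (V : eqType) (e : rel V) (s : seq V) : symmetric e ->
  reflect (forall u w, cadj s u w -> e u w) (cycle e s).
Proof.
move=> es; rewrite cycle_cpairs; apply: (iffP allP) => [H u w /orP[/H|/H]//= | H [u w] uw].
  by rewrite es.
by apply: H; rewrite /cadj uw.
Qed.

(** The 2-opt move: read cyclically, reversing a prefix changes only the edge at the cut and the
    closing edge. *)
Definition flip (V : Type) k (s : seq V) := rev (take k s) ++ drop k s.

Lemma flipK (V : Type) k (s : seq V) : k <= size s -> flip k (flip k s) = s.
Proof.
move=> le; rewrite /flip; have sz : size (rev (take k s)) = k by rewrite size_rev size_takel.
by rewrite take_size_cat // drop_size_cat // revK cat_take_drop.
Qed.

Lemma perm_flip (V : eqType) k (s : seq V) : perm_eq (flip k s) s.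
Proof. by rewrite -{2}(cat_take_drop k s) perm_cat2r perm_rev. Qed.

Lemma size_flip (V : Type) k (s : seq V) : size (flip k s) = size s.
Proof. by rewrite -{2}(cat_take_drop k s) !size_cat size_rev. Qed.

(* The edges of a cyclic sequence x ... x' x'' ... v before and after the 2-opt move
   at position k, which reverses x ... x'. *)
Lemma cadj_cut (V : eqType) (x0 : V) k (s : seq V) u w : 0 < k < size s ->
  cadj s u w = [|| ladj (take k s) u w, ladj (drop k s) u w,
    same_edge (nth x0 s k.-1) (nth x0 s k) u w | same_edge (last x0 s) (head x0 s) u w].
Proof.
case/andP=> k0 kn; rewrite -{1}(cat_take_drop k s).
have s1 : 0 < size (take k s) by rewrite size_takel // ltnW.
have s2 : 0 < size (drop k s) by rewrite size_drop subn_gt0.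
rewrite /cadj (cpairs_cat x0) //.
have -> : last x0 (take k s) = nth x0 s k.-1.
  by rewrite (last_nth x0) size_takel ?(ltnW kn) //; case: k k0 {kn s1 s2} => //= k _; rewrite nth_take.
have -> : head x0 (drop k s) = nth x0 s k by rewrite -nth0 nth_drop addn0.
have -> : last x0 (drop k s) = last x0 s.
  by rewrite -{2}(cat_take_drop k s) last_cat; case: (drop k s) s2.
have -> : head x0 (take k s) = head x0 s by case: (s) k k0 {kn s1 s2} => [|? ?] [].
rewrite !mem_cat !in_cons !mem_rcons !in_cons /ladj /same_edge.
by do ![case: (_ \in _) => //=]; rewrite ?orbT //; do ![case: (_ == _) => //=].
Qed.

Lemma cadj_flip (V : eqType) (x0 : V) k (s : seq V) u w : 0 < k < size s ->
  cadj (flip k s) u w = [|| ladj (take k s) u w, ladj (drop k s) u w,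
    same_edge (head x0 s) (nth x0 s k) u w | same_edge (last x0 s) (nth x0 s k.-1) u w].
Proof.
move=> kn; rewrite (@cadj_cut _ x0 k) ?size_flip //; case/andP: kn => k0 kn.
have sz : size (rev (take k s)) = k by rewrite size_rev size_takel ?(ltnW kn).
have s2 : 0 < size (drop k s) by rewrite size_drop subn_gt0.
have -> : take k (flip k s) = rev (take k s) by rewrite /flip take_size_cat.
have -> : drop k (flip k s) = drop k s by rewrite /flip drop_size_cat.
rewrite ladj_rev.
have -> : nth x0 (flip k s) k = nth x0 s k.
  by rewrite /flip nth_cat sz ltnn subnn nth_drop addn0.
have -> : nth x0 (flip k s) k.-1 = head x0 s.
  rewrite /flip nth_cat sz prednK // leqnn nth_rev size_takel ?(ltnW kn) ?prednK //.
  by rewrite subnn nth_take // nth0.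
have -> : last x0 (flip k s) = last x0 s.
  by rewrite -{2}(cat_take_drop k s) !last_cat; case: (drop k s) s2.
have -> // : head x0 (flip k s) = nth x0 s k.-1.
rewrite -nth0 /flip nth_cat sz k0 nth_rev size_takel ?(ltnW kn) // subn1 nth_take //.
by case: (k) k0.
Qed.

Lemma last_flip (V : Type) (x0 : V) k (s : seq V) : k < size s -> last x0 (flip k s) = last x0 s.
Proof.
move=> kn; have s2 : 0 < size (drop k s) by rewrite size_drop subn_gt0.
by rewrite -{2}(cat_take_drop k s) !last_cat; case: (drop k s) s2.
Qed.

(** The reversed segment keeps its weight because [f] is symmetric. The removed edges stand on the
    left and the new ones on the right, which avoids subtraction in [nat]. *)
Lemma flip_weight (V : eqType) (x0 : V) k (s : seq V) (f : V -> V -> nat) :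
  0 < k < size s -> (forall u w, f u w = f w u) ->
  \sum_(p <- cpairs (flip k s)) f p.1 p.2 +
     (f (nth x0 s k.-1) (nth x0 s k) + f (last x0 s) (head x0 s)) =
  \sum_(p <- cpairs s) f p.1 p.2 + 
     (f (head x0 s) (nth x0 s k) + f (last x0 s) (nth x0 s k.-1)).
Proof.
case/andP=> k0 kn fC.
have s1 : 0 < size (take k s) by rewrite size_takel // ltnW.
have s2 : 0 < size (drop k s) by rewrite size_drop subn_gt0.
have Es : cpairs s = cpairs (take k s ++ drop k s) by rewrite cat_take_drop.
rewrite Es /flip !(cpairs_cat x0) ?size_rev //.
have la : last x0 (take k s) = nth x0 s k.-1.
  by rewrite (last_nth x0) size_takel ?(ltnW kn) //; case: k k0 {kn s1 s2 Es} => //= k _; rewrite nth_take.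
have he : head x0 (take k s) = head x0 s by case: (s) k k0 {kn s1 s2 la Es} => [|? ?] [].
have -> : head x0 (rev (take k s)) = nth x0 s k.-1.
  by rewrite -la -nth0 nth_rev // subn1 nth_last.
have -> : last x0 (rev (take k s)) = head x0 s.
  by rewrite -he; case: (take k s) s1 => // a r _; rewrite rev_cons last_rcons.
have -> : head x0 (drop k s) = nth x0 s k by rewrite -nth0 nth_drop addn0.
have -> : last x0 (drop k s) = last x0 s.
  by rewrite -{2}(cat_take_drop k s) last_cat; case: (drop k s) s2.
rewrite la he !big_cat !big_cons /= !big_rcons /= lpairs_rev.
rewrite (perm_big _ (permEl (perm_rev _))) big_map /=.
under eq_bigr => p _ do rewrite fC.
lia.
Qed.

(** The position of the former last entry tells by how much the sequence was rotated; this makes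
    rotation injective in [switch_count]. *)
Lemma index_rot_last (V : eqType) (x v : V) i (s : seq V) : uniq s -> 0 < size s ->
  last x s = v -> i < size s -> index v (rot i s) = (size s).-1 - i.
Proof.
case/lastP: s => // p y; rewrite last_rcons size_rcons rcons_uniq => /andP[yp _] _ yv; rewrite {y}yv in yp *.
rewrite ltnS => ip; rewrite /rot drop_rcons // -cats1 -catA index_cat.
have /negbTE-> : v \notin drop i p by apply: contra yp => /mem_drop.
by rewrite /= eqxx addn0 size_drop.
Qed.

Lemma flip_tupleP (V : Type) n k (t : n.-tuple V) : size (flip k t) == n.
Proof. by rewrite size_flip size_tuple. Qed.

Definition flip_tuple (V : Type) n k (t : n.-tuple V) : n.-tuple V := Tuple (flip_tupleP k t).

Lemma index_head_flip (V : eqType) (x : V) k (s : seq V) : uniq s -> head x s = x ->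
  0 < k <= size s -> index x (flip k s) = k.-1.
Proof.
case: s => [|y s]; first by case: k.
move=> us /= yx; rewrite {y}yx in us *; case: k => // k /= ks.
rewrite /flip /= rev_cons -cats1 -catA index_cat mem_rev.
have /negbTE-> : x \notin take k s.
  by case/andP: us => xs _; apply: contra xs => /mem_take.
by rewrite /= eqxx addn0 size_rev size_takel.
Qed.

Lemma cpairs_rot_index (V : eqType) (v x : V) (s : seq V) : uniq s -> (v, x) \in cpairs s ->
  [/\ x \in s, head x (rot (index x s) s) = x & last x (rot (index x s) s) = v].
Proof.
move=> us vx; have xs : x \in s.
  case/(nthP (v,x)): vx => i; rewrite /cpairs size_zip size_rot minnn => it.
  by rewrite nth_zip ?size_rot // => -[_ <-]; rewrite -(mem_rot 1) mem_nth // size_rot.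
move: vx us; rewrite -(mem_rot (index x s) (cpairs s)) -cpairs_rot -(rot_uniq (index x s)).
rewrite rot_index //=; set r := (drop _ _ ++ _); rewrite (cpairsE x) // mem_rcons in_cons /=.
case/predU1P => [[->] _|vx /andP[xr _]]; first by [].
(* A pair ending in [x] other than the closing one would put a second [x] behind the head. *)
case/negP: xr; move: vx; rewrite /lpairs /= => /(nthP (v,x))[j].
rewrite size_zip /= => jr; rewrite nth_zip_cond size_zip /= jr => -[_ <-].
by apply: mem_nth; move: jr; rewrite (minn_idPr (leqnSn _)).
Qed.

(* Double counting over all rotations: rotate a cycle using the step v -> x so that it starts
   at x and ends at v; a 2-opt move keeps v in the last place and is undone by the index of x. *)
Lemma switch_count (V : finType) (P : pred (seq V)) (v x : V) (d : nat) :
  (forall s, P s -> uniq s) -> (forall k s, P (rot k s) = P s) ->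
  (forall s, size s = #|V| -> P s -> last x s = v -> head x s = x ->
     d <= #|[set k : 'I_#|V| | (0 < k) && P (flip k s)]|) ->
  d * #|[set t : #|V|.-tuple V | P t && ((v, x) \in cpairs t)]|
    <= #|[set t : #|V|.-tuple V | P t]|.
Proof.
move=> Pu Pr Pd; set N := #|V|; have N0 : 0 < N by apply/card_gt0P; exists x.
pose F0 := [set t : N.-tuple V | [&& P t, head x t == x & last x t == v]].
pose Fv := [set t : N.-tuple V | P t && (last x t == v)].
have h1 : #|[set t : N.-tuple V | P t && ((v, x) \in cpairs t)]| <= N * #|F0|.
  have -> : N * #|F0| = #|setX [set: 'I_N] F0| by rewrite cardsX cardsT card_ord.
  apply: leq_trans (leq_imset_card (fun p : 'I_N * N.-tuple V => [tuple of rotr p.1 p.2]) _).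
  apply: subset_leq_card; apply/subsetP => t; rewrite inE => /andP[Pt vx].
  have [xt ht lt] := cpairs_rot_index (Pu _ Pt) vx.
  have it : index x t < N by rewrite -{2}(size_tuple t) index_mem.
  apply/imsetP; exists (Ordinal it, [tuple of rot (index x t) t]); last first.
    by apply: val_inj; rewrite /= rotK.
  by rewrite !inE /= Pr Pt ht lt !eqxx.
(* All rotations of the sequences ending in [v] are different, since the position of [v] reveals the
   rotation. *)
have h2 : N * #|Fv| <= #|[set t : N.-tuple V | P t]|.
  have -> : N * #|Fv| = #|setX [set: 'I_N] Fv| by rewrite cardsX cardsT card_ord.
  rewrite -(card_in_imset (f := fun p : 'I_N * N.-tuple V => [tuple of rot p.1 p.2])).
    apply: subset_leq_card; apply/subsetP => z /imsetP[[i t]]; rewrite !inE /= => /andP[Pt _] ->.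
    by rewrite Pr.
  move=> [i t] [j u]; rewrite !inE /= => /andP[Pt /eqP lt] /andP[Pu' /eqP lu] /(congr1 val) /= E.
  have : index v (rot i t) = index v (rot j u) by rewrite E.
  rewrite (index_rot_last (Pu _ Pt) _ lt) ?size_tuple // (index_rot_last (Pu _ Pu') _ lu) ?size_tuple //.
  move=> ij; have ij' : i = j by apply: val_inj => /=; case: i j ij {E} => i iN [j jN] /=; lia.
  by subst j; congr pair; apply: val_inj; apply: (rot_inj E).
have h3 : d * #|F0| <= #|Fv|.
  pose D := [set p : N.-tuple V * 'I_N | (p.1 \in F0) && ((0 < p.2) && P (flip p.2 p.1))].
  have hD : d * #|F0| <= #|D|.
    rewrite mulnC -sum_nat_const.
    have -> : #|D| = \sum_(t in F0) \sum_(k : 'I_N | (0 < k) && P (flip k t)) 1.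
      by rewrite pair_big_dep -sum1_card; apply: eq_bigl => -[t k]; rewrite inE.
    apply: leq_sum => t; rewrite inE => /and3P[Pt /eqP ht /eqP lt].
    rewrite sum1_card; apply: leq_trans (Pd t (size_tuple t) Pt lt ht) _.
    by apply: subset_leq_card; apply/subsetP => k; rewrite !inE.
  apply: leq_trans hD _.
  rewrite -(card_in_imset (f := fun p : N.-tuple V * 'I_N => flip_tuple p.2 p.1)).
    apply: subset_leq_card; apply/subsetP => z /imsetP[[t k]].
    rewrite !inE /= => /andP[/and3P[Pt _ lt] /andP[k0 Pk] ->].
    by rewrite /= Pk last_flip // size_tuple.
  move=> [t k] [u l]; rewrite !inE /= => /andP[/and3P[Pt /eqP ht lt] /andP[k0 _]].
  move=> /andP[/and3P[Pu' /eqP hu lu] /andP[l0 _]] /(congr1 val) /= E.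
  have : index x (flip k t) = index x (flip l u) by rewrite E.
  rewrite (index_head_flip (Pu _ Pt) ht) ?size_tuple ?k0 ?(ltnW (ltn_ord k)) //.
  rewrite (index_head_flip (Pu _ Pu') hu) ?size_tuple ?l0 ?(ltnW (ltn_ord l)) // => kl.
  have kl' : k = l by apply: val_inj => /=; case: k l kl k0 l0 {E} => i iN [j jN] /=; lia.
  subst l; congr pair; apply: val_inj; rewrite /= -(@flipK _ k t) ?E ?flipK //;
   by rewrite size_tuple ltnW.
nia.
Qed.

(** * Hamilton cycles through two crossing edges *)

(** Each vertex of [M] has a successor in [s], since the last vertex [v] is not in [M], and each
    vertex outside [C] is the successor of at most one of them. This counts the 2-opt moves whose
    new edges join [v] to [M] and the head to [C]. *)
Lemma flip_choices (V : finType) (s : seq V) (v : V) (M C : {set V}) :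
  uniq s -> size s = #|V| -> last v s = v -> v \notin M ->
  #|M| <= #|[set k : 'I_#|V| | [&& 0 < k, nth v s k.-1 \in M & nth v s k \in C]]| + #|~: C|.
Proof.
move=> us ss lv vM.
have sV u : u \in s.
  have /subset_cardP : #|s| = #|V| by rewrite (card_uniqP us).
  by move=> /(_ (subset_predT _)) ->.
set K := [set k | _]; pose J := [set k : 'I_#|V| | (0 < k) && (nth v s k.-1 \in M)].
have MJ : #|M| <= #|J|.
  apply: leq_trans (leq_imset_card (fun k : 'I_#|V| => nth v s k.-1) _).
  apply: subset_leq_card; apply/subsetP => u uM.
  have lt : (index u s).+1 < #|V|.
    have := sV u; rewrite -index_mem ss leq_eqVlt => /orP[/eqP E|//].
    case/negP: vM; rewrite -lv -nth_last ss -E /= nth_index //.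
  by apply/imsetP; exists (Ordinal lt); rewrite ?inE /= nth_index.
have JK : J \subset K :|: [set k : 'I_#|V| | nth v s k \in ~: C].
  by apply/subsetP => k; rewrite !inE => /andP[-> ->] /=; case: (_ \in C).
apply: leq_trans MJ (leq_trans (subset_leq_card JK) (leq_trans (leq_card_setU _ _) _)).
rewrite leq_add2l -(card_in_imset (f := fun k : 'I_#|V| => nth v s k)).
  by apply: subset_leq_card; apply/subsetP => z /imsetP[k]; rewrite inE => kC ->.
move=> i j _ _ /eqP; rewrite nth_uniq ?ss //; move=> /eqP ij; exact: val_inj.
Qed.

(** As [g] is irreflexive, [inner_miss] counts [x] itself. The constants leave room for linearly
    many 2-opt moves: the degree [#|V|/6] well exceeds the loss of at most [#|V|/100] at a good
    vertex. *)
Record inner_graph (V : finType) (A Good : {set V}) (g : rel V) : Prop := {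
  inner_sym : symmetric g;
  inner_side : forall u w, g u w -> (u \in A) = (w \in A);
  inner_good : forall u w, g u w -> (u \in Good) || (w \in Good);
  inner_deg : forall v, #|V| <= 6 * #|[set w | g v w]|;
  inner_miss : forall x, x \in Good ->
    100 * #|[set w | ((w \in A) == (x \in A)) && ~~ g x w]| <= #|V|;
  inner_bad : 100 * #|~: Good| <= #|V|;
  inner_irr : irreflexive g }.

Definition link (V : eqType) (a1 b1 a2 b2 : V) : rel V :=
  fun u w => same_edge a1 b1 u w || same_edge a2 b2 u w.

(** The pairs [a1 b1] and [a2 b2] will be the two crossing edges, so that [g] carries the rest of
    the cycle. *)
Definition host (V : eqType) (g : rel V) (a1 b1 a2 b2 : V) : rel V :=
  fun u w => g u w || link a1 b1 a2 b2 u w.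

Lemma same_edgeC (V : eqType) (a b u w : V) : same_edge a b u w = same_edge a b w u.
Proof. by rewrite /same_edge orbC. Qed.

Lemma host_sym (V : eqType) (g : rel V) (a1 b1 a2 b2 : V) :
  symmetric g -> symmetric (host g a1 b1 a2 b2).
Proof. by move=> gs u w; rewrite /host /link gs (same_edgeC a1) (same_edgeC a2). Qed.

Lemma host_inner (V : finType) (g : rel V) (a1 b1 a2 b2 u w : V) :
  host g a1 b1 a2 b2 u w -> u \notin [set a1; b1; a2; b2] -> g u w.
Proof.
rewrite /host /link /same_edge !xpair_eqE !inE.
case: (g u w) => //=; do 4![case: (u =P _) => //= _]; by rewrite !andbF.
Qed.

(** * The probability of using an edge *)

Definition occurs (V : eqType) (q : (V * V) * (V * V)) (s : seq V) :=
  cadj s q.1.1 q.1.2 && cadj s q.2.1 q.2.2.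

(** The list [L] prescribes edges, so that the probability of using two edges can be found by
    conditioning on one of them. The cycles become Hamiltonian by being taken as tuples of length
    [#|V|]. *)
Definition admissible (V : finType) (h : rel V) (S : {set (V * V) * (V * V)})
    (L : seq (V * V)) (s : seq V) :=
  [&& uniq s, [forall u, forall w, cadj s u w ==> h u w],
      [forall q in S, ~~ occurs q s] & all (fun f => cadj s f.1 f.2) L].

Lemma eq_admissible (V : finType) (h : rel V) S L (s s' : seq V) :
  uniq s = uniq s' -> cadj s =2 cadj s' -> admissible h S L s = admissible h S L s'.
Proof.
move=> us E; rewrite /admissible us; congr [&& _, _, _ & _].
- by apply: eq_forallb => u; apply: eq_forallb => w; rewrite E.
- by apply: eq_forallb => q; rewrite /occurs !E.
- by apply: eq_all => f /=; rewrite E.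
Qed.

Lemma admissible_rot (V : finType) (h : rel V) S L k (s : seq V) :
  admissible h S L (rot k s) = admissible h S L s.
Proof. by apply: eq_admissible; [apply: rot_uniq | apply: cadj_rot]. Qed.

Lemma admissible_rev (V : finType) (h : rel V) S L (s : seq V) :
  admissible h S L (rev s) = admissible h S L s.
Proof. by apply: eq_admissible; [apply: rev_uniq | apply: cadj_rev]. Qed.

Definition touches (V : eqType) (q : (V * V) * (V * V)) (v : V) :=
  v \in [:: q.1.1; q.1.2; q.2.1; q.2.2].

Lemma same_edgeP (V : eqType) (a b u w : V) :
  reflect ((u = a /\ w = b) \/ (u = b /\ w = a)) (same_edge a b u w).
Proof.
apply: (iffP orP); rewrite !xpair_eqE.
  by move=> [/andP[/eqP-> /eqP->]|/andP[/eqP-> /eqP->]]; [left|right].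
by move=> [[-> ->]|[-> ->]]; [left|right]; rewrite !eqxx.
Qed.

(** Both new edges of the move meet the last vertex [v] or the head [x], so that an edge avoiding
    [v] and [x] was there before. *)
Lemma cadj_flip_off (V : eqType) (v x : V) k (s : seq V) u w : 0 < k < size s ->
  last v s = v -> head v s = x -> u != v -> u != x -> w != v -> w != x ->
  cadj (flip k s) u w -> cadj s u w.
Proof.
move=> kn lv hx uv ux wv wx; rewrite (cadj_flip v) // lv hx (cadj_cut v _ _ kn).
case/or4P=> [->//|->|/same_edgeP|/same_edgeP]; first by rewrite orbT.
  by case=> -[E1 E2]; move: ux wx; rewrite ?E1 ?E2 eqxx.
by case=> -[E1 E2]; move: uv wv; rewrite ?E1 ?E2 eqxx.
Qed.

(** With the cycle cut open between [v] and [x], the move replaces [vx] and [yz] by [vy] and [xz].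
    It suffices to take for [y] an inner neighbour of [v] that is no end of a crossing or prescribed
    edge: then [yz] is inner, so [z] lies on the side of [x], where the good vertex [x] misses few
    vertices. Hence a cycle using the step has at least [#|V|/8] switches, and none of them creates
    an event of [S]. *)
Lemma edge_switch (V : finType) (A Good : {set V}) (g : rel V) (a1 b1 a2 b2 : V)
    (S : {set (V * V) * (V * V)}) (L : seq (V * V)) (v x : V) :
  inner_graph A Good g -> 10 * 100 <= #|V| -> size L <= 1 -> g v x -> x \in Good ->
  (forall q, q \in S -> ~~ touches q v && ~~ touches q x) ->
  (forall f, f \in L -> ~~ same_edge v x f.1 f.2) ->
  #|V| * #|[set t : #|V|.-tuple V | admissible (host g a1 b1 a2 b2) S L t && ((v, x) \in cpairs t)]|
    <= 8 * #|[set t : #|V|.-tuple V | admissible (host g a1 b1 a2 b2) S L t]|.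
Proof.
move=> [gC gside ggood gdeg gmiss gbad girr] V1000 L1 gvx xG HS HL.
set h := host _ _ _ _ _; set P := admissible h S L.
have hC : symmetric h by apply: host_sym.
(* The number of switches is [#|V|/8], rounded up. *)
have main := @switch_count V P v x ((#|V| + 7) %/ 8).
have le8 : #|V| <= 8 * ((#|V| + 7) %/ 8) by lia.
suff : (#|V| + 7) %/ 8 * #|[set t : #|V|.-tuple V | P t && ((v, x) \in cpairs t)]|
    <= #|[set t : #|V|.-tuple V | P t]| by nia.
apply: main => [s /andP[]//|k s|s ss Ps lv hx]; first exact: admissible_rot.
have hx' : head v s = x by case: (s) ss hx => //= E; move: V1000; rewrite -E.
have lv' : last v s = v by case: (s) ss lv => //= E; move: V1000; rewrite -E.
have := Ps; case/and4P=> us hs Ss Ls.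
have {}hs u w : cadj s u w -> h u w by move: hs => /forallP/(_ u)/forallP/(_ w)/implyP.
(* Keeping [y] off [E] prevents crossing edges and edges of [L] from being removed as [yz]. *)
pose E := a1 :: b1 :: a2 :: b2 :: flatten [seq [:: f.1; f.2] | f <- L].
pose M := [set w | g v w] :\: [set w in E].
(* The whole other side is put into [C]; that [z] lies on the side of [x] follows from the choice of
   [y]. *)
pose C := [set w | ((w \in A) == (x \in A)) ==> g x w].
have vM : v \notin M by rewrite !inE girr andbF.
have := flip_choices C us ss lv' vM.
have := gdeg v; have := gmiss x xG.
have -> : [set w | (w \in A) == (x \in A) & ~~ g x w] = ~: C.
  by apply/setP => w; rewrite !inE negb_imply.
have cE : #|[set w in E]| <= 6.
  rewrite cardsE; apply: leq_trans (card_size _) _; rewrite /= /E.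
  by case: (L) L1 => [|f []].
have := cardsD [set w | g v w] [set w in E]; rewrite -/M => cM.
have := subset_leq_card (subsetIr [set w | g v w] [set w in E]).
set K := [set k : 'I__ | _] => c1 c2 c3 c4.
suff KP : K \subset [set k : 'I_#|V| | (0 < k) && P (flip k s)].
  by apply: leq_trans (subset_leq_card KP); lia.
apply/subsetP => k; rewrite !inE => /and3P[k0 /andP[kE gk] kC]; rewrite k0 /=.
have kn : 0 < k < size s by rewrite k0 ss /=.
move: kE gk kC; set y := nth v s k.-1; set z := nth v s k => yE gvy zC.
have gyz : g y z.
  apply: (@host_inner _ g a1 b1 a2 b2); first apply: hs.
    by rewrite (cadj_cut v _ _ kn); apply/or4P; apply: Or43; apply/same_edgeP; left.
  by apply: contra yE; rewrite !inE -!orbA => /or4P[] ->; rewrite ?orbT.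
have gxz : g x z.
  by move: zC; rewrite -(gside _ _ gyz) -(gside _ _ gvy) (gside _ _ gvx) eqxx.
apply/and4P; split.
- by rewrite (perm_uniq (perm_flip _ _)).
- apply/forallP => u; apply/forallP => w; apply/implyP.
  rewrite (cadj_flip v) // lv' hx' -/y -/z; case/or4P => [H|H|/same_edgeP|/same_edgeP].
  + by apply: hs; rewrite (cadj_cut v _ _ kn) H.
  + by apply: hs; rewrite (cadj_cut v _ _ kn) H orbT.
  + by case=> -[-> ->]; rewrite /h /host ?gxz // gC gxz.
  + by case=> -[-> ->]; rewrite /h /host ?gvy // gC gvy.
- apply/forall_inP => q qS; apply/negP => /andP[o1 o2].
  case/negP: (forall_inP Ss q qS).
  have /andP[] := HS q qS; rewrite /touches !inE !negb_or.
  case/and4P=> n1 n2 n3 n4 /and4P[n5 n6 n7 n8].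
  by apply/andP; split; [apply: (cadj_flip_off kn lv' hx' _ _ _ _ o1) |
     apply: (cadj_flip_off kn lv' hx' _ _ _ _ o2)]; rewrite eq_sym.
- apply/allP => f fL; have := allP Ls f fL; have nf := HL f fL.
  have [yf1 yf2] : y != f.1 /\ y != f.2.
    split; apply: contra yE => /eqP->; do 4![apply/orP; right];
      by apply/flattenP; exists [:: f.1; f.2]; rewrite ?inE ?eqxx ?orbT //; apply/mapP; exists f.
  rewrite (cadj_cut v _ _ kn) (cadj_flip v _ _ kn) lv' hx' (negbTE nf) -/y.
  case/or4P => [->//|->|/same_edgeP|//]; first by rewrite orbT.
  by case=> -[E1 E2]; move: yf1 yf2; rewrite ?E1 ?E2 eqxx.
Qed.

(** One end of an inner edge is good and may be taken as [x]. The factor 16 is twice that of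
    [edge_switch], for the two directions in which a cycle may run through the edge; reversal
    exchanges them. *)
Lemma edge_probability (V : finType) (A Good : {set V}) (g : rel V) (a1 b1 a2 b2 : V)
    (S : {set (V * V) * (V * V)}) (L : seq (V * V)) (v x : V) :
  inner_graph A Good g -> 10 * 100 <= #|V| -> size L <= 1 -> g v x ->
  (forall q, q \in S -> ~~ touches q v && ~~ touches q x) ->
  (forall f, f \in L -> ~~ same_edge v x f.1 f.2) ->
  #|V| * #|[set t : #|V|.-tuple V | admissible (host g a1 b1 a2 b2) S L t && cadj t v x]|
    <= 16 * #|[set t : #|V|.-tuple V | admissible (host g a1 b1 a2 b2) S L t]|.
Proof.
move=> ig V1000 L1; wlog xG : v x / x \in Good => [W|] gvx HS HL.
  have /orP[vG|] := inner_good ig gvx; last by move=> xG; apply: W.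
  have := W x v vG; rewrite (inner_sym ig x v) => /(_ gvx).
  under eq_finset => t do rewrite cadjC.
  apply=> [q /HS|f /HL]; first by rewrite andbC.
  by apply: contra => /same_edgeP E; apply/same_edgeP; case: E; [right|left].
have main := edge_switch a1 b1 a2 b2 ig V1000 L1 gvx xG HS HL.
set P := admissible _ _ _ in main *.
set X := [set t : #|V|.-tuple V | P t & (v, x) \in cpairs t] in main *.
pose Y := [set t : #|V|.-tuple V | P t & (x, v) \in cpairs t].
have YX : #|Y| <= #|X|.
  rewrite -(card_in_imset (f := fun t : #|V|.-tuple V => [tuple of rev t])).
    apply: subset_leq_card; apply/subsetP => z /imsetP[t]; rewrite !inE => /andP[Pt xv] ->.
    rewrite /= /P admissible_rev -/P Pt; have [k ->] := cpairs_rev t.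
    by rewrite mem_rot mem_rev -[(v, x)]swap_pairK (mem_map (can_inj (@swap_pairK V V))).
  by move=> t u _ _ /(congr1 val) /= /(can_inj revK) E; apply: val_inj.
have XY : [set t : #|V|.-tuple V | P t && cadj t v x] \subset X :|: Y.
  by apply/subsetP => t; rewrite !inE /cadj => /andP[-> /orP[]->]; rewrite ?orbT.
have := leq_trans (subset_leq_card XY) (leq_card_setU _ _).
nia.
Qed.

(** * A Hamilton cycle in the host graph *)

Lemma ladj_mem (V : eqType) (s : seq V) u w : ladj s u w -> (u \in s) && (w \in s).
Proof.
have mem y z : (y, z) \in lpairs s -> (y \in s) && (z \in s).
  move=> /(nthP (y, y))[j]; rewrite /lpairs size_zip size_behead => js.
  rewrite nth_zip_cond size_zip size_behead js => -[<- <-].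
  by rewrite !mem_nth ?nth_behead ?mem_nth //; lia.
by case/orP => /mem //; rewrite andbC.
Qed.

Definition same_side (V : finType) (A : {set V}) (u w : V) := (u \in A) == (w \in A).

(** List [A] from [a1] to [a2], then its complement from [b2] to [b1]: the two blocks meet in
    [a2 b2] and in the closing [b1 a1]. *)
Lemma two_sided_cycle (V : finType) (A : {set V}) (a1 b1 a2 b2 : V) :
  a1 \in A -> a2 \in A -> b1 \notin A -> b2 \notin A -> a1 != a2 -> b1 != b2 ->
  exists s, [/\ uniq s, size s = #|V| &
    forall u w, cadj s u w -> same_side A u w || link a1 b1 a2 b2 u w].
Proof.
move=> a1A a2A b1A b2A a12 b12.
pose s1 := a1 :: rcons (enum (A :\ a1 :\ a2)) a2.
pose s2 := b2 :: rcons (enum (~: A :\ b1 :\ b2)) b1.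
have m1 u : (u \in s1) = (u \in A).
  rewrite in_cons mem_rcons in_cons mem_enum !inE.
  by case: (u =P a1) => [->|_] //=; case: (u =P a2) => [->|_].
have m2 u : (u \in s2) = (u \notin A).
  rewrite in_cons mem_rcons in_cons mem_enum !inE.
  by case: (u =P b2) => [->|_] /=; [rewrite b2A | case: (u =P b1) => [->|_] /=; rewrite ?b1A ?orbT ?orbF].
have u12 : uniq (s1 ++ s2).
  rewrite cat_uniq; apply/and3P; split; last 1 first.
  - rewrite /= mem_rcons in_cons mem_enum rcons_uniq mem_enum enum_uniq !inE !eqxx /=.
    by rewrite ?andbF ?orbF ?andbT /= eq_sym b12.
  - rewrite /= mem_rcons in_cons mem_enum rcons_uniq mem_enum enum_uniq !inE !eqxx /=.
    by rewrite ?andbF ?orbF ?andbT /= a12.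
  - by apply/hasPn => u; rewrite m2 m1.
exists (s1 ++ s2); split=> //.
  rewrite -(card_uniqP u12); apply: eq_card => u.
  by rewrite mem_cat m1 m2 orbN.
have k0 : 0 < size s1 < size (s1 ++ s2) by rewrite size_cat /= !size_rcons; lia.
move=> u w; rewrite (cadj_cut a1 _ _ k0) take_size_cat // drop_size_cat //.
case/or4P=> [/ladj_mem|/ladj_mem||].
- by rewrite !m1 /same_side => /andP[-> ->].
- by rewrite !m2 /same_side => /andP[/negbTE-> /negbTE->].
- have -> : nth a1 (s1 ++ s2) (size s1).-1 = a2 by rewrite nth_cat prednK // leqnn nth_last /= last_rcons.
  have -> : nth a1 (s1 ++ s2) (size s1) = b2 by rewrite nth_cat ltnn subnn.
  by rewrite /link => ->; rewrite !orbT.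
- rewrite last_cat /= last_rcons /link same_edgeC => /same_edgeP H; apply/orP; right; apply/orP; left.
  by apply/same_edgeP; tauto.
Qed.

(* A missing edge with two bad ends has weight 2, so that replacing it by a missing edge with
   a good end is progress; the latter can be removed by a single 2-opt move. *)
Definition defect (V : finType) (Good : {set V}) (h : rel V) (u w : V) : nat :=
  if h u w then 0 else if (u \in Good) || (w \in Good) then 1 else 2.

Definition total_defect (V : finType) (Good : {set V}) (h : rel V) (s : seq V) :=
  \sum_(p <- cpairs s) defect Good h p.1 p.2.

Lemma total_defect_rot (V : finType) (Good : {set V}) (h : rel V) k s :
  total_defect Good h (rot k s) = total_defect Good h s.
Proof. by rewrite /total_defect cpairs_rot; apply/perm_big/permEl/perm_rot. Qed.

Lemma total_defect_rev (V : finType) (Good : {set V}) (h : rel V) s : symmetric h ->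
  total_defect Good h (rev s) = total_defect Good h s.
Proof.
move=> hC; rewrite /total_defect; have [k ->] := cpairs_rev s.
rewrite (perm_big _ (permEl (perm_rot _ _))) (perm_big _ (permEl (perm_rev _))) big_map.
by apply: eq_bigr => p _; rewrite /defect /= hC orbC.
Qed.

(** The move at the missing edge [vx] adds [xz] and an edge [vy] of [g]. If [x] is good, [z] can be
    chosen adjacent to [x], and the defect of [vx] disappears. If [x] is bad, so is [v], and a good
    [z] turns weight 2 into weight at most 1. Both new edges stay inside a side, so the move can be
    repeated. *)
Lemma defect_step (V : finType) (A Good : {set V}) (g : rel V) (a1 b1 a2 b2 v x : V) (s : seq V) :
  inner_graph A Good g -> 10 * 100 <= #|V| -> let h := host g a1 b1 a2 b2 in
  uniq s -> size s = #|V| -> last v s = v -> head v s = x ->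
  (forall u w, cadj s u w -> same_side A u w || link a1 b1 a2 b2 u w) ->
  0 < defect Good h v x -> (v \in Good) ==> (x \in Good) ->
  exists k, total_defect Good h (flip k s) < total_defect Good h s /\
    forall u w, cadj (flip k s) u w -> same_side A u w || link a1 b1 a2 b2 u w.
Proof.
(* Here [p] and [t] stand for the new and the old total, [q] and [r] for the weights of the removed
   [yz] and [vx], [u] for that of [xz], and 0 for that of [vy]. *)
have arith (p q r t u : nat) : p + (q + r) = t + (u + 0) -> u < r -> p < t by lia.
move=> [gC gside ggood gdeg gmiss gbad girr] V1000 h us ss lv hx K vx0 vxG.
have hC : symmetric h by apply: host_sym.
pose ends := [:: a1; b1; a2; b2].
have off u w : same_side A u w || link a1 b1 a2 b2 u w -> u \notin ends -> same_side A u w.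
  rewrite /link /same_edge !xpair_eqE !inE; case: (same_side _ _ _) => //=.
  by do 4![case: (u =P _) => //= _]; rewrite !andbF.
have sVX : same_side A v x.
  have : cadj s v x.
    have s0 : 0 < size s by rewrite ss; lia.
    by rewrite /cadj (cpairsE v) // lv hx mem_rcons in_cons eqxx.
  move/K => /orP[//|l]; move: vx0; rewrite /defect /h /host l orbT //.
pose M := [set w | g v w] :\: [set w in ends].
pose C := [set w | same_side A w x ==> (if x \in Good then g x w else w \in Good)].
have vM : v \notin M by rewrite !inE girr andbF.
have := flip_choices C us ss lv vM.
have cC : 100 * #|~: C| <= #|V|.
  rewrite /C; case xG: (x \in Good).
    apply: leq_trans (gmiss x xG); rewrite leq_mul2l /=; apply: subset_leq_card.
    by apply/subsetP => w; rewrite !inE negb_imply.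
  apply: leq_trans gbad; rewrite leq_mul2l /=; apply: subset_leq_card.
  by apply/subsetP => w; rewrite !inE negb_imply => /andP[].
have cE : #|[set w in ends]| <= 4 by rewrite cardsE; apply: leq_trans (card_size _) _.
have := cardsD [set w | g v w] [set w in ends]; rewrite -/M => cM.
have := subset_leq_card (subsetIr [set w | g v w] [set w in ends]).
have := gdeg v.
set KK := [set k : 'I__ | _] => c1 c2 c3.
have /card_gt0P[k] : 0 < #|KK| by lia.
rewrite !inE => /and3P[k0 /andP[kE gk] kC].
have kn : 0 < k < size s by rewrite k0 ss /=.
exists k; move: kE gk kC; set y := nth v s k.-1; set z := nth v s k => yE gvy zC.
have syz : same_side A y z.
  apply: off; first apply: K; last by move: yE; rewrite !inE.
  by rewrite (cadj_cut v _ _ kn); apply/or4P; apply: Or43; apply/same_edgeP; left.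
have sxz : same_side A z x.
  by rewrite /same_side -(eqP syz) -(gside _ _ gvy) (eqP sVX).
move: zC; rewrite sxz /= => zC.
have hvy : h v y by rewrite /h /host gvy.
split; last first.
  move=> u w; rewrite (cadj_flip v) // lv hx -/y -/z; case/or4P => [H|H|/same_edgeP|/same_edgeP].
  - by apply: K; rewrite (cadj_cut v _ _ kn) H.
  - by apply: K; rewrite (cadj_cut v _ _ kn) H orbT.
  - by case=> -[-> ->]; rewrite /same_side (eqP sxz) eqxx.
  - by case=> -[-> ->]; rewrite /same_side (gside _ _ gvy) eqxx.
have dC u w : defect Good h u w = defect Good h w u by rewrite /defect hC orbC.
have : total_defect Good h (flip k s) + (defect Good h y z + defect Good h v x) =
    total_defect Good h s + (defect Good h x z + defect Good h v y).
  by have := flip_weight v kn dC; rewrite lv hx.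
have -> : defect Good h v y = 0 by rewrite /defect hvy.
move=> /arith; apply.
move: zC vxG; case: ifP => xG zC vxG.
  by rewrite {1}/defect /h /host zC.
move: vx0; rewrite /defect; case: (h v x) => // _; rewrite xG zC implybF in vxG *.
by rewrite (negbTE vxG) orbT; case: ifP.
Qed.

(** Starting from the ordering of [two_sided_cycle], each application of [defect_step] lowers the
    total defect, until no edge is missing. *)
Lemma host_hamiltonian (V : finType) (A Good : {set V}) (g : rel V) (a1 b1 a2 b2 : V) :
  inner_graph A Good g -> 10 * 100 <= #|V| ->
  a1 \in A -> a2 \in A -> b1 \notin A -> b2 \notin A -> a1 != a2 -> b1 != b2 ->
  exists s, [/\ uniq s, size s = #|V| & forall u w, cadj s u w -> host g a1 b1 a2 b2 u w].
Proof.
move=> ig V1000 a1A a2A b1A b2A a12 b12; set h := host _ _ _ _ _.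
have hC : symmetric h by apply: host_sym; case: ig.
have [s [us ss K]] := two_sided_cycle a1A a2A b1A b2A a12 b12.
have [m] := ubnP (total_defect Good h s); elim: m s us ss K => // m IH s us ss K ltm.
have [/hasP[[v x] vx /= d0]|/hasPn H] := boolP (has (fun p => 0 < defect Good h p.1 p.2) (cpairs s));
  last first.
  exists s; split=> // u w; wlog uw : u w / (u, w) \in cpairs s => [W|_].
    by move=> /orP[uw|uw]; [|rewrite hC]; apply: W => //; rewrite /cadj uw.
  by have := H _ uw; rewrite /defect /=; case: (h u w) => //; case: ifP.
have step v' x' s' : uniq s' -> size s' = #|V| -> cadj s' =2 cadj s ->
    total_defect Good h s' = total_defect Good h s -> (v', x') \in cpairs s' ->
    0 < defect Good h v' x' -> (v' \in Good) ==> (x' \in Good) ->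
    exists s, [/\ uniq s, size s = #|V| & forall u w, cadj s u w -> h u w].
  move=> us' ss' E D vx' d0' G; have [xs hx lv] := cpairs_rot_index us' vx'.
  set r := rot _ _ in hx lv.
  have r0 : 0 < size r by rewrite size_rot ss'; apply: leq_trans V1000.
  have hx' : head v' r = x' by case: (r) r0 hx.
  have lv' : last v' r = v' by case: (r) r0 lv.
  have ur : uniq r by rewrite rot_uniq.
  have sr : size r = #|V| by rewrite size_rot.
  have Kr u w : cadj r u w -> same_side A u w || link a1 b1 a2 b2 u w.
    by rewrite cadj_rot E; apply: K.
  have [k [lt Kf]] := defect_step ig V1000 ur sr lv' hx' Kr d0' G.
  apply: (IH (flip k r)) => //.
  - by rewrite (perm_uniq (perm_flip _ _)).
  - by rewrite size_flip.
  - by rewrite -ltnS; apply: leq_trans lt _; rewrite total_defect_rot D.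
(* If only [v] is good, the reversed sequence is used, in which [v] takes the place of [x]. *)
have [G|G] := boolP ((v \in Good) ==> (x \in Good)); first by apply: (step v x s).
apply: (step x v (rev s)).
- by rewrite rev_uniq.
- by rewrite size_rev.
- exact: cadj_rev.
- exact: total_defect_rev.
- have [k ->] := cpairs_rev s.
  by rewrite mem_rot mem_rev -[(x, v)]swap_pairK (mem_map (can_inj (@swap_pairK V V))).
- by move: d0; rewrite /defect hC orbC.
- by move: G; rewrite negb_imply => /andP[-> _]; rewrite implybT.
Qed.

(** * Monochromatic pairs and the local lemma *)

Definition conflict (V : finType) (g : rel V) (col : V -> V -> nat) (q : (V * V) * (V * V)) :=
  [&& g q.1.1 q.1.2, g q.2.1 q.2.2, col q.1.1 q.1.2 == col q.2.1 q.2.2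
    & ~~ same_edge q.1.1 q.1.2 q.2.1 q.2.2].

(** There are four places for [v] in the pair, then [#|V|] choices for the other end of its edge
    and, the colour being known, at most [m] for the other edge. *)
Lemma card_conflict_touching (V : finType) (g : rel V) (col : V -> V -> nat) (m : nat) (v : V) :
  symmetric g -> (forall u w, col u w = col w u) ->
  (forall k, #|[set p : V * V | g p.1 p.2 && (col p.1 p.2 == k)]| <= m) ->
  #|[set q | conflict g col q && touches q v]| <= 4 * (#|V| * m).
Proof.
move=> gC cC Hm.
pose D := [set p : V * (V * V) | g p.2.1 p.2.2 && (col p.2.1 p.2.2 == col v p.1)].
have cD : #|D| <= #|V| * m.
  have -> : #|D| = \sum_(b : V) \sum_(p : V * V | g p.1 p.2 && (col p.1 p.2 == col v b)) 1.
    by rewrite pair_big_dep -sum1_card; apply: eq_bigl => -[b p]; rewrite inE.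
  rewrite -sum_nat_const; apply: leq_sum => b _; rewrite sum1_card.
  by apply: leq_trans (Hm (col v b)); apply: subset_leq_card; apply/subsetP => p; rewrite inE.
pose f1 (p : V * (V * V)) := ((v, p.1), p.2); pose f2 (p : V * (V * V)) := ((p.1, v), p.2).
pose f3 (p : V * (V * V)) := (p.2, (v, p.1)); pose f4 (p : V * (V * V)) := (p.2, (p.1, v)).
have sub : [set q | conflict g col q && touches q v]
    \subset (f1 @: D :|: f2 @: D) :|: (f3 @: D :|: f4 @: D).
  apply/subsetP => -[[x y] [z w]]; rewrite inE /conflict /touches !inE /= => /andP[/and4P[g1 g2 /eqP c12 _]].
  case/or4P => /eqP E; subst v; rewrite -!orbA; apply/or4P.
  - by apply: Or41; apply/imsetP; exists (y, (z, w)); rewrite ?inE //= g2 c12 eqxx.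
  - by apply: Or42; apply/imsetP; exists (x, (z, w)); rewrite ?inE //= g2 -c12 cC eqxx.
  - by apply: Or43; apply/imsetP; exists (w, (x, y)); rewrite ?inE //= g1 c12 eqxx.
  - by apply: Or44; apply/imsetP; exists (z, (x, y)); rewrite ?inE //= g1 c12 cC eqxx.
apply: leq_trans (subset_leq_card sub) _.
have U (X Y : {set (V * V) * (V * V)}) : #|X :|: Y| <= #|X| + #|Y| := leq_card_setU X Y.
have I (f : V * (V * V) -> (V * V) * (V * V)) : #|f @: D| <= #|V| * m.
  exact: leq_trans (leq_imset_card _ _) cD.
apply: leq_trans (U _ _) _; rewrite [4 * _](mulnDl 2 2) !mulSn !mul0n !addn0.
by apply: leq_add; (apply: leq_trans (U _ _) _; apply: leq_add).
Qed.

(** The local lemma is applied with probability [256/#|V|^2], where 256 is 16 squared, and with at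
    most [16 * #|V| * m] neighbours of an event: its four vertices contribute the bound of
    [card_conflict_touching] each. Since [4 * 256 * 16] is [128 * 128], the condition on [m] is the
    one required. *)
Lemma rainbow_host_cycle (V : finType) (A Good : {set V}) (g : rel V) (a1 b1 a2 b2 : V)
    (col : V -> V -> nat) (m : nat) :
  inner_graph A Good g -> 10 * 100 <= #|V| ->
  a1 \in A -> a2 \in A -> b1 \notin A -> b2 \notin A -> a1 != a2 -> b1 != b2 ->
  (forall u w, col u w = col w u) ->
  (forall k, #|[set p : V * V | g p.1 p.2 && (col p.1 p.2 == k)]| <= m) ->
  128 * 128 * m <= #|V| ->
  exists s, [/\ uniq s, size s = #|V|, forall u w, cadj s u w -> host g a1 b1 a2 b2 u w
    & forall u w u' w', cadj s u w -> cadj s u' w' -> g u w -> g u' w' ->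
        col u w = col u' w' -> same_edge u w u' w'].
Proof.
move=> ig V1000 a1A a2A b1A b2A a12 b12 cC Hm mV; have gC := inner_sym ig.
set h := host g a1 b1 a2 b2.
pose W := [set t : #|V|.-tuple V | admissible h set0 [::] t].
pose B (q : (V * V) * (V * V)) (t : #|V|.-tuple V) := occurs q t.
pose Q := [set q | conflict g col q].
pose nb (p q : (V * V) * (V * V)) := [exists v, touches p v && touches q v].
have avE S : avoiding W B S = [set t : #|V|.-tuple V | admissible h S [::] t].
  apply/setP => t; rewrite !inE /admissible /= !andbT; case: (uniq t) => //=.
  case: [forall u, _] => //=; suff -> : [forall q in set0, ~~ occurs q t] by [].
  by apply/forall_inP => q; rewrite inE.
have [t] : exists t, t \in avoiding W B Q.
  apply: (@lopsided_local_lemma _ _ W B Q nb 256 (#|V| * #|V|)).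
  - have [s [us ss Hs]] := host_hamiltonian ig V1000 a1A a2A b1A b2A a12 b12.
    have sT : size s == #|V| by rewrite ss.
    apply/card_gt0P; exists (Tuple sT); rewrite inE /admissible us /= andbT.
    apply/andP; split; last by apply/forall_inP => q; rewrite inE.
    by apply/forallP => u; apply/forallP => w; apply/implyP; apply: Hs.
  - nia.
  - move=> q S; rewrite inE => /and4P[g1 g2 _ n12] _ HS; rewrite avE.
    have far v : touches q v -> forall p, p \in S -> ~~ touches p v.
      move=> qv p /HS; apply: contra => pv; apply/existsP; exists v; by rewrite qv.
    have offS x y : touches q x -> touches q y ->
        forall p, p \in S -> ~~ touches p x && ~~ touches p y.
      by move=> qx qy p pS; rewrite (far x qx p pS) (far y qy p pS).
    have off1 : forall p, p \in S -> ~~ touches p q.1.1 && ~~ touches p q.1.2.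
      by apply: offS; rewrite /touches !inE eqxx ?orbT.
    have off2 : forall p, p \in S -> ~~ touches p q.2.1 && ~~ touches p q.2.2.
      by apply: offS; rewrite /touches !inE eqxx ?orbT.
    have n12' : forall f, f \in [:: q.2] -> ~~ same_edge q.1.1 q.1.2 f.1 f.2.
      by move=> f; rewrite inE => /eqP->.
    have no : forall f : V * V, f \in [::] -> ~~ same_edge q.2.1 q.2.2 f.1 f.2 by [].
    (* Chain rule: given that [S] is avoided, the second edge is used with probability at most
       [16/#|V|], and given this too, so is the first. *)
    have := edge_probability a1 b1 a2 b2 ig V1000 (isT : size [:: q.2] <= 1) g1 off1 n12'.
    have := @edge_probability V A Good g a1 b1 a2 b2 S [::] q.2.1 q.2.2 ig V1000 isT g2 off2
      no; rewrite -/h.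
    have -> : [set t0 : #|V|.-tuple V | admissible h S [:: q.2] t0 & cadj t0 q.1.1 q.1.2] =
        [set t0 in [set t1 : #|V|.-tuple V | admissible h S [::] t1] | B q t0].
      apply/setP => t; rewrite !inE /admissible /B /occurs /= !andbT -!andbA.
      by rewrite [cadj t q.2.1 _ && _]andbC.
    have -> : [set t0 : #|V|.-tuple V | admissible h S [:: q.2] t0] =
       [set t0 : #|V|.-tuple V | admissible h S [::] t0 & cadj t0 q.2.1 q.2.2].
      by apply/setP => t; rewrite !inE /admissible /= !andbT -!andbA.
    set X := #|_|; set Y := #|_|; set Z := #|_| => h1 h2.
    have : #|V| * (#|V| * Z) <= #|V| * (16 * X) by rewrite leq_mul2l h2 orbT.
    by move: h1 {h2}; move: #|V| X Y Z => N X Y Z; clear; lia.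
  - move=> q _.
    pose T v := [set p | conflict g col p && touches p v].
    have cT v : #|T v| <= 4 * (#|V| * m) := card_conflict_touching v gC cC Hm.
    have sub : [set p in Q | nb q p] \subset (T q.1.1 :|: T q.1.2) :|: (T q.2.1 :|: T q.2.2).
      apply/subsetP => p; rewrite in_set => /andP[].
      rewrite in_set => cp /existsP[v /andP[qv pv]].
      have : [|| v == q.1.1, v == q.1.2, v == q.2.1 | v == q.2.2] by move: qv; rewrite /touches !inE.
      by rewrite !in_setU !in_set cp /= => /or4P[] /eqP <-; rewrite pv ?orbT.
    have U (X Y : {set (V * V) * (V * V)}) k l : #|X| <= k -> #|Y| <= l -> #|X :|: Y| <= k + l.
      by move=> Xk Yl; apply: leq_trans (leq_card_setU X Y) _; apply: leq_add.
    have := leq_trans (subset_leq_card sub) (U _ _ _ _ (U _ _ _ _ (cT _) (cT _)) (U _ _ _ _ (cT _) (cT _))).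
    have : #|V| * (128 * 128 * m) <= #|V| * #|V| by rewrite leq_mul2l mV orbT.
    move: #|V| #|_| => N X; clear; lia.
rewrite avE inE => /and4P[ut Ht Qt _].
exists t; split=> //; first exact: size_tuple.
  by move=> u w uw; move: Ht => /forallP/(_ u)/forallP/(_ w)/implyP; apply.
move=> u w u' w' cuw cuw' guw guw' cc; apply/negPn/negP => ns.
have := forall_inP Qt ((u, w), (u', w')); rewrite inE /conflict /= guw guw' cc eqxx ns.
by move=> /(_ isT); rewrite /occurs /= cuw cuw'.
Qed.

(** * The partition and the crossing edges *)

Definition crossing (V : finType) (A : {set V}) (e : rel V) (v : V) : {set V} :=
  [set w | e v w & ~~ same_side A v w].

(** The [+ 2] arises because [v] lies in its own side but is not its own neighbour. *)
Lemma crossing_degree (V : finType) (A : {set V}) (e : rel V) (v : V) :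
  irreflexive e -> #|V| <= 2 * #|[set w | e v w]| ->
  #|V| + 2 <= 2 * (#|[set w | same_side A v w]| + #|crossing A e v|).
Proof.
move=> eI; suff : #|[set w | e v w]| + 1 <= #|[set w | same_side A v w]| + #|crossing A e v|.
  by move: #|V| #|_| #|_| #|_| => p q r t; clear; lia.
have -> : #|[set w | same_side A v w]| = #|[set w | same_side A v w] :\ v| + 1.
  by rewrite (cardsD1 v [set w | _]) inE /same_side eqxx addnC.
rewrite addnAC leq_add2r; apply: leq_trans (leq_card_setU _ _).
apply: subset_leq_card; apply/subsetP => w; rewrite !inE => ew; rewrite ew /=.
by case: (same_side A v w); rewrite ?orbT // andbT orbF; apply: contraTneq ew => ->; rewrite eI.
Qed.

(** If no edge completes a crossing edge [ab], all crossing edges disjoint from [ab] have its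
    colour. When [A] is smaller than half, each of its vertices has two crossing edges, hence one
    avoiding [b], and this colour appears too often. When [A] is exactly half, each vertex has at
    least one, and the pair is formed by an edge at [b] and an edge at [a]. *)
Lemma crossing_edges (V : finType) (e : rel V) (col : V -> V -> nat) (A : {set V}) (m : nat) :
  symmetric e -> irreflexive e -> (forall v, #|V| <= 2 * #|[set w | e v w]|) ->
  (forall u w, col u w = col w u) ->
  (forall k, #|[set p : V * V | e p.1 p.2 && (col p.1 p.2 == k)]| <= m) ->
  2 * #|A| <= #|V| -> 2 * m + 1 < #|A| ->
  exists a1 b1 a2 b2, [/\ [&& a1 \in A, a2 \in A, b1 \notin A & b2 \notin A],
    a1 != a2 /\ b1 != b2, e a1 b1 /\ e a2 b2 & col a1 b1 != col a2 b2].
Proof.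
move=> eC eI ed cC cm An mA.
have tb (z : bool) : (true == z) = z by case: z.
have fb (z : bool) : (false == z) = ~~ z by case: z.
have cd v := crossing_degree A eI (ed v).
have cAA : #|A| + #|~: A| = #|V| by rewrite cardsC.
have sA v : v \in A -> [set w | same_side A v w] = A.
  by move=> vA; apply/setP => w; rewrite inE /same_side vA; case: (w \in A).
have sB v : v \notin A -> [set w | same_side A v w] = ~: A.
  by move=> /negbTE vA; apply/setP => w; rewrite !inE /same_side vA; case: (w \in A).
have dA v : v \in A -> #|V| + 2 <= 2 * (#|A| + #|crossing A e v|).
  by move=> vA; have := cd v; rewrite (sA v vA).
have dB v : v \notin A -> #|V| + 2 <= 2 * (#|~: A| + #|crossing A e v|).
  by move=> vA; have := cd v; rewrite (sB v vA).
have [a aA] : exists a, a \in A by apply/card_gt0P; apply: leq_trans mA.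
have [b] : exists b, b \in crossing A e a.
  by apply/card_gt0P; move: (dA a aA) An; clear; lia.
rewrite inE /same_side aA tb => /andP[eab bA].
pose cls k := [set p : V * V | e p.1 p.2 && (col p.1 p.2 == k)].
have [/existsP[[a' b']] |/existsPn F] := boolP [exists p : V * V, [&& p.1 \in A, p.1 != a, p.2 \notin A,
    p.2 != b, e p.1 p.2 & col p.1 p.2 != col a b]].
  case/and5P => /= a'A aa' b'A bb' /andP[ea'b' cc].
  by exists a', b', a, b; split=> //; rewrite ?aA ?a'A ?bA ?b'A.
have {}F u w : u \in A -> u != a -> w \notin A -> w != b -> e u w -> col u w = col a b.
  move=> uA ua wA wb euw; apply/eqP; apply/negPn/negP => cc.
  by have := F (u, w); rewrite /= uA ua wA wb euw cc.
have big1 (X : {set V}) : X \subset (fst @: cls (col a b)) -> #|X| <= m.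
  by move=> /subset_leq_card h; apply: leq_trans h (leq_trans (leq_imset_card _ _) (cm _)).
have cA1 : #|A :\ a| + 1 = #|A| by rewrite (cardsD1 a A) aA addnC.
have [lt|ge] := ltnP (2 * #|A|) #|V|.
  exfalso; suff /big1 : A :\ a \subset fst @: cls (col a b) by move: mA cA1; clear; lia.
  apply/subsetP => u; rewrite !inE => /andP[ua uA].
  have : 0 < #|crossing A e u :\ b|.
    by have := dA u uA; rewrite (cardsD1 b (crossing A e u)); move: lt; clear; case: (_ \in _) => /=; lia.
  case/card_gt0P => w; rewrite !inE /same_side uA tb => /and3P[wb euw wA].
  by apply/imsetP; exists (u, w); rewrite // inE /= euw F ?eqxx.
(* If [a] were the only neighbour of [b] in [A], every other vertex of [A] would have a crossing
   edge of the colour of [ab]. *)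
have [a' /and3P[a'A a'a ea'b]] : exists a', [&& a' \in A, a' != a & e a' b].
  have [/existsP //|/existsPn H] := boolP [exists u, [&& u \in A, u != a & e u b]].
  exfalso; suff /big1 : A :\ a \subset fst @: cls (col a b) by move: mA cA1; clear; lia.
  apply/subsetP => u; rewrite !inE => /andP[ua uA].
  have : 0 < #|crossing A e u| by have := dA u uA; move: An; clear; lia.
  case/card_gt0P => w; rewrite !inE /same_side uA tb => /andP[euw wA].
  apply/imsetP; exists (u, w); rewrite // inE /= euw F ?eqxx //.
  by apply: contraTneq euw => ->; have := H u; rewrite uA ua.
have cB1 : #|~: A :\ b| + 1 = #|~: A| by rewrite (cardsD1 b (~: A)) inE bA addnC.
(* Otherwise every vertex outside [A] except [b] has an edge to [a] of the colour of [a'b], or an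
   edge to another vertex of [A] of the colour of [ab]; two colours are too few for this. *)
have [b' /and4P[b'A b'b eab' cc]] : exists b', [&& b' \notin A, b' != b, e a b' & col a b' != col a' b].
  have [/existsP //|/existsPn H] :=
    boolP [exists w, [&& w \notin A, w != b, e a w & col a w != col a' b]].
  exfalso.
  have : #|~: A :\ b| <= m + m.
    have sub : ~: A :\ b \subset (snd @: cls (col a b)) :|: (snd @: cls (col a' b)).
      apply/subsetP => w; rewrite !inE => /andP[wb wA]; have := H w; rewrite wA wb /= negb_and negbK.
      have [eaw /= /eqP caw|naw _] := boolP (e a w); apply/orP; [right|left]; apply/imsetP.
        by exists (a, w); rewrite // inE /= eaw caw eqxx.
      have : 0 < #|crossing A e w|.
        by have := dB w wA; move: ge cAA; clear; lia.
      case/card_gt0P => u; rewrite !inE /same_side (negbTE wA) => /andP[ewu].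
      rewrite fb negbK => uA; exists (u, w); rewrite // inE /= eC ewu /= F ?eqxx //.
        by apply: contraTneq ewu => ->; rewrite eC.
      by rewrite eC.
    apply: leq_trans (subset_leq_card sub) (leq_trans (leq_card_setU _ _) _).
    by apply: leq_add; apply: leq_trans (leq_imset_card _ _) (cm _).
  by move: mA An ge cAA cB1; clear; lia.
exists a', b, a, b'; split; rewrite ?aA ?a'A ?bA ?b'A //; last by rewrite eq_sym.
by split=> //; rewrite eq_sym.
Qed.

(** Only good neighbours count in [pair_deg], because a bad vertex will keep only its edges to good
    ones. *)
Record near_clique_pair (V : finType) (e : rel V) (A Good : {set V}) : Prop := {
  pair_deg : forall v, #|V| <= 5 * #|[set w in Good | same_side A v w && e v w]|;
  pair_miss : forall x, x \in Good ->
    150 * #|[set w | same_side A x w && ~~ e x w]| <= #|V|;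
  pair_bad : 1000 * #|~: Good| <= #|V|;
  pair_left : exists v, v \in A;
  pair_right : exists v, v \notin A }.

(** Crossing degrees sum to at most twice the cut, so at most [#|V|/1000] vertices have crossing
    degree above [#|V|/200]. These form [X], the bad vertices; each goes to the side holding at
    least half of its neighbours, of which at most [#|X|] are lost. Any other vertex has all but
    [#|V|/200] of its neighbours in its own side, which has about [#|V|/2] vertices, so it misses
    few of them. *)
Lemma near_clique_pair_exists (V : finType) (e : rel V) (A0 : {set V}) :
  symmetric e -> irreflexive e -> (forall v, #|V| <= 2 * #|[set w | e v w]|) ->
  #|A0| = #|V|./2 -> 10 * 1000 <= #|V| ->
  400 * 1000 * #|[set p : V * V | [&& p.1 \in A0, p.2 \notin A0 & e p.1 p.2]]| <= #|V| * #|V| ->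
  exists A Good, near_clique_pair e A Good.
Proof.
move=> eC eI ed cA0 Vbig cut.
pose cr v := #|crossing A0 e v|.
pose X := [set v | #|V| < 200 * cr v].
have sumcr : \sum_(v : V) cr v <= 2 * #|[set p : V * V | [&& p.1 \in A0, p.2 \notin A0 & e p.1 p.2]]|.
  set K := [set p | _].
  have -> : \sum_(v : V) cr v = #|[set p : V * V | e p.1 p.2 && ~~ same_side A0 p.1 p.2]|.
    transitivity (\sum_(v : V) \sum_(w : V | e v w && ~~ same_side A0 v w) 1).
      by apply: eq_bigr => v _; rewrite sum1_card; apply: eq_card => w; rewrite inE.
    by rewrite pair_big_dep -sum1_card; apply: eq_bigl => -[v w]; rewrite inE.
  have sub : [set p : V * V | e p.1 p.2 && ~~ same_side A0 p.1 p.2] \subset K :|: (swap_pair @: K).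
    apply/subsetP => -[v w]; rewrite !inE /= /same_side => /andP[evw s].
    case vA: (v \in A0) s; case wA: (w \in A0) => //= _; rewrite ?evw //=.
    by apply/imsetP; exists (w, v); rewrite // inE /= wA vA eC.
  apply: leq_trans (subset_leq_card sub) (leq_trans (leq_card_setU _ _) _).
  by rewrite mul2n -addnn leq_add2l leq_imset_card.
have X1000 : 1000 * #|X| <= #|V|.
  have h : #|X| * #|V| <= 200 * \sum_(v : V) cr v.
    rewrite -sum_nat_const big_distrr /= [leqRHS](bigID (mem X)) /=.
    apply: leq_trans (leq_addr _ _); apply: leq_sum => v; rewrite inE; exact: ltnW.
  have V0 : 0 < #|V| by apply: leq_trans Vbig.
  move: h cut sumcr V0; move: #|V| #|X| (\sum_(v : V) cr v) #|_| => n x sc k; clear => h cut sumcr n0.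
  rewrite -(leq_pmul2l n0); lia.
pose A := [set v | if v \in X then #|[set w in ~: A0 | e v w]| <= #|[set w in A0 | e v w]| else v \in A0].
have AX v : v \notin X -> (v \in A) = (v \in A0) by move=> /negbTE vX; rewrite inE vX.
have cB0 : #|A0| + #|~: A0| = #|V| by rewrite cardsC.
have splitd v : #|[set w | e v w]| = #|[set w in A0 | e v w]| + #|[set w in ~: A0 | e v w]|.
  rewrite -(cardsID A0); congr (_ + _); apply: eq_card => w; rewrite !inE andbC //.
have sumU (Y Z : {set V}) : #|Y| <= #|Z :&: Y| + #|~: Z|.
  rewrite -(cardsID Z) setIC leq_add2l; apply: subset_leq_card.
  by apply/subsetP => w; rewrite !inE => /andP[].
have degX (D : {set V}) v : (forall w, w \notin X -> w \in D -> same_side A v w) ->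
    #|[set w in D | e v w]| <= #|[set w in ~: X | same_side A v w && e v w]| + #|X|.
  move=> H; rewrite -{2}(setCK X); apply: leq_trans (sumU _ (~: X)) _.
  rewrite leq_add2r; apply: subset_leq_card; apply/subsetP => w; rewrite !inE -/X.
  move=> /and3P[wX wD ->]; have wX' : w \notin X by rewrite inE.
  by rewrite wX (H w wX' wD).
have goodd v : v \notin X -> #|[set w | e v w]| <= cr v + #|[set w in [set w | same_side A0 v w] | e v w]|.
  move=> vX; rewrite addnC -(cardsID [set w | same_side A0 v w]); apply: leq_add; apply: subset_leq_card.
    by apply/subsetP => w; rewrite !inE andbC.
  by apply/subsetP => w; rewrite !inE andbC.
have card_side v : 2 * #|[set w | same_side A0 v w]| <= #|V| + 1.
  have : 2 * #|A0| <= #|V| /\ #|V| <= 2 * #|A0| + 1 by rewrite cA0; have := odd_double_half #|V|; lia.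
  case vA: (v \in A0).
    have -> : [set w | same_side A0 v w] = A0 by apply/setP => w; rewrite inE /same_side vA; case: (_ \in _).
    by move: #|A0| #|V|; clear; lia.
  have -> : [set w | same_side A0 v w] = ~: A0 by apply/setP => w; rewrite !inE /same_side vA; case: (_ \in _).
  by move: #|A0| #|V| #|~: A0| cB0; clear; lia.
have X0 (D : {set V}) : #|X| < #|D| -> exists2 v, v \notin X & v \in D.
  move=> lt; have [/existsP[v /andP[vX vD]]|/existsPn H] := boolP [exists v, (v \notin X) && (v \in D)].
    by exists v.
  suff : D \subset X by move/subset_leq_card; move: lt; clear; lia.
  by apply/subsetP => v vD; have := H v; rewrite vD andbT negbK.
(* Hence each side keeps a vertex that was not moved. *)
have XA : #|X| < #|A0| /\ #|X| < #|~: A0|.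
  have := odd_double_half #|V|; move: cB0 X1000 Vbig; rewrite cA0.
  by move: #|V| #|X| #|~: A0|; clear => n k l; case: (odd n) => /=; lia.
exists A, (~: X); split.
- move=> v; have := ed v; case vX: (v \in X).
    have de := splitd v; case vA: (v \in A).
      have dv := degX A0 v.
      have le : #|[set w in ~: A0 | e v w]| <= #|[set w in A0 | e v w]| by move: vA; rewrite inE vX.
      have /dv : forall w, w \notin X -> w \in A0 -> same_side A v w.
        by move=> w wX wA; rewrite /same_side vA (AX w wX) wA.
      move: de le X1000 Vbig.
      move: #|V| #|X| #|_| #|_| #|_| #|_|; clear => *; lia.
    have dv := degX (~: A0) v.
    have le : #|[set w in A0 | e v w]| <= #|[set w in ~: A0 | e v w]|.
      by move/negbT: vA; rewrite inE vX -ltnNge; apply: ltnW.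
    have /dv : forall w, w \notin X -> w \in ~: A0 -> same_side A v w.
      by move=> w wX; rewrite inE => /negbTE wA; rewrite /same_side vA (AX w wX) wA.
    move: de le X1000 Vbig.
    move: #|V| #|X| #|_| #|_| #|_| #|_|; clear => *; lia.
  have crv : 200 * cr v <= #|V| by move/negbT: vX; rewrite inE -leqNgt.
  have /degX : forall w, w \notin X -> w \in [set w | same_side A0 v w] -> same_side A v w.
    by move=> w wX; rewrite inE /same_side (AX w wX) (AX v (negbT vX)).
  have := goodd v (negbT vX); move: crv X1000 Vbig.
  move: #|V| (cr v) #|X| #|_| #|_| #|_|; clear => *; lia.
- move=> x; rewrite inE => xX.
  have crv : 200 * cr x <= #|V| by move: xX; rewrite inE -leqNgt.
  have sub : #|[set w | same_side A x w & ~~ e x w]| <=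
      #|[set w | same_side A0 x w & ~~ e x w]| + #|X|.
    apply: leq_trans (leq_card_setU _ _); apply: subset_leq_card; apply/subsetP => w.
    rewrite [in X in _ -> X]in_setU; case wX: (w \in X); first by rewrite orbT.
    by rewrite orbF !in_set /same_side (AX x xX) (AX w (negbT wX)).
  have E : #|[set w | same_side A0 x w]| =
      #|[set w in [set w | same_side A0 x w] | e x w]| + #|[set w | same_side A0 x w & ~~ e x w]|.
    rewrite -(cardsID [set w | e x w]); congr (_ + _); apply: eq_card => w; rewrite !inE //.
    by rewrite andbC.
  have := goodd x xX; have := card_side x; have := ed x; move: crv sub E X1000 Vbig.
  move: #|V| (cr x) #|X| #|_| #|_| #|_| #|_| #|_|; clear => *; lia.
- by rewrite setCK.
- by have [v vX vA] := X0 _ (proj1 XA); exists v; rewrite (AX v vX).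
- by have [v vX vA] := X0 _ (proj2 XA); exists v; rewrite (AX v vX); move: vA; rewrite inE.
Qed.

(** * From the partition to the theorem *)

Lemma cpairs_asym (V : eqType) (s : seq V) (u w : V) : uniq s -> 2 < size s ->
  (u, w) \in cpairs s -> (w, u) \notin cpairs s.
Proof.
move=> us s3 uw; have [_ hw lu] := cpairs_rot_index us uw.
rewrite -(mem_rot (index w s) (cpairs s)) -cpairs_rot.
move: us s3 hw lu; rewrite -(rot_uniq (index w s)) -(size_rot (index w s)).
case: (rot _ s) => [|x [|y [|z r]]] //= /andP[xr /andP[yr _]] _ xw lu {uw}; rewrite {x}xw in xr *.
(* With [w] first and [u] last, the pair [(w, u)] could only be the first one, making [u] both
   second and last among at least three vertices. *)
rewrite /cpairs rot1_cons /= in_cons negb_or; apply/andP; split.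
  apply: contra yr; rewrite xpair_eqE => /andP[_ /eqP <-].
  by rewrite -lu mem_last.
have nw : w \notin unzip1 (zip [:: y, z & r] (z :: rcons r w)).
  by rewrite unzip1_zip; [exact: xr | rewrite /= size_rcons].
by apply: contra nw => /(map_f fst).
Qed.

Lemma near_clique_pairC (V : finType) (e : rel V) (A Good : {set V}) :
  near_clique_pair e A Good -> near_clique_pair e (~: A) Good.
Proof.
have sC u w : same_side (~: A) u w = same_side A u w.
  by rewrite /same_side !inE; case: (u \in A); case: (w \in A).
case=> h1 h2 h3 [v vA] [w wA]; split=> //.
- move=> u; apply: leq_trans (h1 u) _; rewrite leq_mul2l /=; apply: subset_leq_card.
  by apply/subsetP => z; rewrite !in_set sC.
- move=> u uG; apply: leq_trans (h2 u uG); rewrite leq_mul2l /=; apply: subset_leq_card.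
  by apply/subsetP => z; rewrite !in_set sC.
- by exists w; rewrite inE.
- by exists v; rewrite inE vA.
Qed.

(** At each vertex, at most [2 * m] edges have one of the two crossing colours, so forbidding these
    colours in [g] weakens the constants 5 and 150 of the partition only to 6 and 100. Crossing and
    inner edges then share no colour, and [rainbow_host_cycle] separates the inner edges from each
    other. *)
Lemma rainbow_near_clique_pair (V : finType) (e : rel V) (col : V -> V -> nat) (A Good : {set V}) (m : nat) :
  symmetric e -> irreflexive e -> (forall v, #|V| <= 2 * #|[set w | e v w]|) ->
  (forall u w, col u w = col w u) ->
  (forall k, #|[set p : V * V | e p.1 p.2 && (col p.1 p.2 == k)]| <= m) ->
  128 * 128 * m <= #|V| -> 10 * 1000 <= #|V| -> near_clique_pair e A Good ->
  exists s, [/\ uniq s, size s = #|V|, forall u w, cadj s u w -> e u w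
    & uniq [seq col p.1 p.2 | p <- cpairs s]].
Proof.
(* The smaller side is called [A], as [crossing_edges] requires. *)
move=> eC eI ed cC cm mV Vbig; wlog An : A / 2 * #|A| <= #|V| => [W P|].
  have [le|lt] := leqP (2 * #|A|) #|V|; first exact: (W A).
  apply: (W (~: A)); last exact: near_clique_pairC.
  by have := cardsC A; move: lt; clear; lia.
case=> pdeg pmiss pbad [a aA] [b bA].
have sC u w : same_side A u w = same_side A w u by rewrite /same_side eq_sym.
have cA v : v \in A -> 2 * m + 1 < #|A|.
  move=> vA; have : #|[set w in Good | same_side A v w & e v w]| <= #|A|.
    apply: subset_leq_card; apply/subsetP => w; rewrite inE /same_side vA.
    by case/and3P => _; case: (w \in A).
  by have := pdeg v; move: mV Vbig; move: #|V| #|_| #|A|; clear => *; lia.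
have [a1 [b1 [a2 [b2 [/and4P[a1A a2A b1A b2A] [a12 b12] [e1 e2] c12]]]]] :=
  crossing_edges eC eI ed cC cm An (cA a aA).
pose ok u w := (col u w != col a1 b1) && (col u w != col a2 b2).
pose g u w := [&& e u w, same_side A u w, (u \in Good) || (w \in Good) & ok u w].
pose cls k := [set p : V * V | e p.1 p.2 && (col p.1 p.2 == k)].
have star v k : #|[set w | e v w & col v w == k]| <= m.
  apply: leq_trans (cm k); rewrite -(card_imset _ (f := pair v)); last by move=> x y [].
  apply: subset_leq_card; apply/subsetP => p /imsetP[w]; rewrite inE => H ->.
  by rewrite inE.
have ig : inner_graph A Good g.
  split.
  - by move=> u w; rewrite /g /ok eC sC cC orbC.
  - by move=> u w /and4P[_ /eqP].
  - by move=> u w /and4P[].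
  - move=> v; have := pdeg v; have := star v (col a1 b1); have := star v (col a2 b2).
    have sub : [set w in Good | same_side A v w & e v w] \subset
       [set w | g v w] :|: ([set w | e v w & col v w == col a1 b1] :|: [set w | e v w & col v w == col a2 b2]).
      apply/subsetP => w; rewrite !inE /g /ok => /and3P[-> -> ->]; rewrite orbT /=.
      by case: (_ == col a1 b1); case: (_ == col a2 b2).
    have := leq_trans (subset_leq_card sub) (leq_trans (leq_card_setU _ _)
      (leq_add (leqnn _) (leq_card_setU _ _ : _ <= _))).
    move: mV Vbig; move: #|V| #|_| #|_| #|_| #|_|; clear => *; lia.
  - move=> x xG; have := pmiss x xG; have := star x (col a1 b1); have := star x (col a2 b2).
    have sub : [set w | (w \in A) == (x \in A) & ~~ g x w] \subset
       [set w | same_side A x w & ~~ e x w] :|: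
       ([set w | e x w & col x w == col a1 b1] :|: [set w | e x w & col x w == col a2 b2]).
      apply/subsetP => w; rewrite !inE /g /ok xG /= eq_sym /same_side.
      by case: ((x \in A) == _); case: (e x w); case: (_ == col a1 b1); case: (_ == col a2 b2).
    have := leq_trans (subset_leq_card sub) (leq_trans (leq_card_setU _ _)
      (leq_add (leqnn _) (leq_card_setU _ _ : _ <= _))).
    move: mV Vbig; move: #|V| #|_| #|_| #|_| #|_|; clear => *; lia.
  - by move: pbad; move: #|_| #|_|; clear => *; lia.
  - by move=> v; rewrite /g eI.
have gm k : #|[set p : V * V | g p.1 p.2 && (col p.1 p.2 == k)]| <= m.
  apply: leq_trans (cm k); apply: subset_leq_card; apply/subsetP => p.
  by rewrite !inE => /andP[/and4P[-> _ _ _] ->].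
have V1000 : 10 * 100 <= #|V| by apply: leq_trans Vbig.
have [s [us ss Hs rb]] := rainbow_host_cycle ig V1000 a1A a2A b1A b2A a12 b12 cC gm mV.
have se u w : cadj s u w -> e u w.
  move=> /Hs /orP[/and4P[]//|/orP[]/same_edgeP[]].
  - by case=> -> ->.
  - by case=> -> ->; rewrite eC.
  - by case=> -> ->.
  - by case=> -> ->; rewrite eC.
exists s; split=> //.
have linkc u w : same_edge a1 b1 u w -> col u w = col a1 b1.
  by case/same_edgeP=> -[-> ->] //; rewrite cC.
have linkc2 u w : same_edge a2 b2 u w -> col u w = col a2 b2.
  by case/same_edgeP=> -[-> ->] //; rewrite cC.
have trans x y u w u' w' : same_edge x y u w -> same_edge x y u' w' -> same_edge u w u' w'.
  by case/same_edgeP=> -[-> ->] /same_edgeP H; apply/same_edgeP; tauto.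
(* Each of the two edges is inner, or the first or the second crossing edge; edges of different
   kinds have different colours. *)
have key u w u' w' : cadj s u w -> cadj s u' w' -> col u w = col u' w' -> same_edge u w u' w'.
  move=> h1 h2 cc; have /orP[g1|/orP[l1|l1]] := Hs _ _ h1; have /orP[g2|/orP[l2|l2]] := Hs _ _ h2.
  - exact: rb.
  - by move: g1; rewrite /g /ok cc (linkc _ _ l2) eqxx !andbF.
  - by move: g1; rewrite /g /ok cc (linkc2 _ _ l2) eqxx !andbF.
  - by move: g2; rewrite /g /ok -cc (linkc _ _ l1) eqxx !andbF.
  - exact: trans l1 l2.
  - by move: c12; rewrite -(linkc _ _ l1) -(linkc2 _ _ l2) cc eqxx.
  - by move: g2; rewrite /g /ok -cc (linkc2 _ _ l1) eqxx !andbF.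
  - by move: c12; rewrite -(linkc2 _ _ l1) -(linkc _ _ l2) cc eqxx.
  - exact: trans l1 l2.
rewrite map_inj_in_uniq; first by rewrite /cpairs zip_uniql.
move=> [u w] [u' w'] h1 h2 /= cc.
(* A cycle of length two would list its edge twice. *)
have s3 : 2 < size s by rewrite ss; apply: leq_trans Vbig.
have c1 : cadj s u w by rewrite /cadj h1.
have c2 : cadj s u' w' by rewrite /cadj h2.
case/same_edgeP: (key _ _ _ _ c1 c2 cc) => -[E1 E2]; subst u' w'; first by [].
by case/negP: (cpairs_asym us s3 h1).
Qed.

Lemma INR_leq (i j : nat) : (INR i <= INR j)%R -> i <= j.
Proof. by move=> H; apply/leP; apply: INR_le. Qed.

Theorem mainTheorem6 :
  exists gamma0 : R, (0 < gamma0)%R /\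
  forall gamma : R, (0 < gamma <= gamma0)%R ->
  exists (mu0 : R) (n0 : nat), (0 < mu0)%R /\
  forall (mu : R) (n : nat), (0 < mu <= mu0)%R -> (n0 <= n)%N ->
  forall e : rel 'I_n, simple_graph e -> min_deg_half e -> gamma_close e gamma ->
  forall c : 'I_n -> 'I_n -> nat, edge_colouring c ->
    bounded_colouring e c (mu * INR n)%R ->
  exists s : seq 'I_n, hamilton_cycle e s /\ rainbow_cycle c s.
Proof.
have arith q x y n : 0 < q -> x <= 2 * y -> 2 * q * y <= n -> x <= n %/ q.
  by move=> q0 h h'; rewrite leq_divRL //; apply: leq_trans h'; nia.
(* The constant [K] is that of the cut bound in [near_clique_pair_exists]. In [M] the extra factor 2
   appears because a colour class counts each edge once, while [m] bounds the number of its oriented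
   edges. *)
pose K := 400 * 1000; pose M := 2 * (128 * 128).
have K0 : (0 < INR K)%R by apply: lt_0_INR; apply/ltP.
have M0 : (0 < INR M)%R by apply: lt_0_INR; apply/ltP.
have K1 : INR K <> 0%R := Rgt_not_eq _ _ K0.
have M1 : INR M <> 0%R := Rgt_not_eq _ _ M0.
exists (/ INR K)%R; split; first exact: Rinv_0_lt_compat.
move=> gamma [_ gle]; exists (/ INR M)%R, (10 * 1000); split; first exact: Rinv_0_lt_compat.
move=> mu n [_ mule] nbig e [eC eI] deg2 [A0 [cA0 cut]] c cC cb.
have n0R : (0 <= INR n)%R by apply: pos_INR.
have ed v : #|'I_n| <= 2 * #|[set w | e v w]|.
  rewrite card_ord; apply: INR_leq; rewrite mult_INR.
  have := deg2 v; rewrite /deg; change (INR 2) with 2%R; lra.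
have cutN : K * cut_size e A0 <= n * n.
  apply: INR_leq; rewrite (mult_INR K) (mult_INR n).
  have : (INR (cut_size e A0) <= / INR K * INR n ^ 2)%R.
    by apply: Rle_trans cut _; apply: Rmult_le_compat_r => //; apply: pow_le.
  move/(Rmult_le_compat_l (INR K) _ _ (Rlt_le _ _ K0)).
  have -> : (INR n ^ 2 = INR n * INR n)%R by rewrite -Rsqr_pow2.
  by rewrite -Rmult_assoc Rinv_r // Rmult_1_l.
have clsN k : M * colour_class_size e c k <= n.
  apply: INR_leq; rewrite (mult_INR M).
  have : (INR (colour_class_size e c k) <= / INR M * INR n)%R.
    by apply: Rle_trans (cb k) _; apply: Rmult_le_compat_r.
  move/(Rmult_le_compat_l (INR M) _ _ (Rlt_le _ _ M0)).
  by rewrite -Rmult_assoc Rinv_r // Rmult_1_l.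
pose m := n %/ (128 * 128).
have cm k : #|[set p : 'I_n * 'I_n | e p.1 p.2 && (c p.1 p.2 == k)]| <= m.
  set U := [set p : 'I_n * 'I_n | [&& (p.1 < p.2)%N, e p.1 p.2 & c p.1 p.2 == k]].
  have sub : [set p : 'I_n * 'I_n | e p.1 p.2 && (c p.1 p.2 == k)] \subset U :|: (swap_pair @: U).
    apply/subsetP => -[u w]; rewrite !inE /= => /andP[euw cuw].
    case: (ltngtP u w) => [_|wu|/val_inj uw]; first by rewrite euw cuw.
      by apply/imsetP; exists (w, u); rewrite // inE /= wu eC euw cC cuw.
    by move: euw; rewrite uw eI.
  have : #|[set p : 'I_n * 'I_n | e p.1 p.2 && (c p.1 p.2 == k)]| <= 2 * #|U|.
    apply: leq_trans (subset_leq_card sub) (leq_trans (leq_card_setU _ _) _).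
    by rewrite mul2n -addnn leq_add2l leq_imset_card.
  move=> h; rewrite /m; move: (clsN k) h; rewrite /M /colour_class_size -/U.
  by move=> h1 h2; apply: arith h2 h1; rewrite muln_gt0.
have Vbig : 10 * 1000 <= #|'I_n| by rewrite card_ord.
have [||A [Good P]] := @near_clique_pair_exists _ e A0 eC eI ed _ Vbig.
- by rewrite card_ord.
- by rewrite card_ord.
have mV : 128 * 128 * m <= #|'I_n| by rewrite card_ord mulnC leq_divM.
have [s [us ss Hs rb]] := rainbow_near_clique_pair eC eI ed cC cm mV Vbig P.
exists s; split=> //; split; first by apply: leq_trans nbig.
split; last by apply/cycle_cadj.
apply: uniq_perm => //; first exact: enum_uniq.
move=> u; rewrite mem_enum; have /subset_cardP : #|s| = #|'I_n| by rewrite (card_uniqP us).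
by move=> /(_ (subset_predT _)) ->.
Qed.
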